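(* Let $F_2$ be the free group of rank $2$ with a fixed basis. The number of potentially positive words in $F_2$ of length $n$ is $\Theta(\lambda_1^n)$, where $\lambda_1\approx 2.50506841362147$ is the largest root of the polynomial $\lambda^4-3\lambda^3+\lambda^2+\lambda-1$.
   Context: Words in a free group $F_r=F(x_1,\dots,x_r)$ are reduced words in the letters $x_i^{\pm1}$, and length is the number of letters. A word is positive if it can be expressed as a product of the generators $x_1,\dots,x_r$ without inverses. A word $w\in F_r$ is potentially positive if some automorphism of $F_r$ maps $w$ to a positive word. For functions $f,g$ on $\mathbb N$: $f\in O(g)$ if there exist constants $C,m$ with $Cg(n)>f(n)$ for all $n\ge m$; $f\in\Omega(g)$ if $g\in O(f)$; $\Theta(g)=O(g)\cap\Omega(g)$. *)

(* Defs.v *)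
From HB Require Import structures.
From mathcomp Require Import all_boot all_order all_algebra.
From mathcomp Require Import boolp reals.

Set Implicit Arguments.
Unset Strict Implicit.
Unset Printing Implicit Defensive.

Import GRing.Theory Num.Theory.

Section FreeGroup.
Variable r : nat.

(* The letter (i, true) is the generator x_i and (i, false) its inverse. *)
Local Notation letter := ('I_r * bool)%type.
Implicit Types (a b : letter) (s t u : seq letter).

Definition invl (a : letter) : letter := (a.1, ~~ a.2).

Definition reduced (s : seq letter) : bool :=
  sorted (fun a b => b != invl a) s.

Record freeGroup := FreeGroup { word :> seq letter; _ : reduced word }.

HB.instance Definition _ := [isSub for word].
HB.instance Definition _ := [Choice of freeGroup by <:].

Lemma invlK : involutive invl.
Proof. by case=> i b; rewrite /invl /= negbK. Qed.

(* Reduced form of a :: s, for s reduced. *)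
Definition consr (a : letter) (s : seq letter) : seq letter :=
  if s is b :: s' then if b == invl a then s' else a :: s else [:: a].

(* Reduced form of s ++ t, for t reduced. *)
Definition catr (s t : seq letter) : seq letter := foldr consr t s.

Lemma reduced_cons a s : reduced (a :: s) -> reduced s.
Proof. by case: s => //= b s /andP[]. Qed.

Lemma consr_reduced a s : reduced s -> reduced (consr a s).
Proof.
case: s => //= b s Hs; case: ifP => [_ | /negbT Hb]; last by rewrite /= Hb.
exact: (@reduced_cons b).
Qed.

Lemma catr_reduced s t : reduced t -> reduced (catr s t).
Proof. by move=> Ht; elim: s => //= a s IHs; apply: consr_reduced. Qed.

Lemma consr_id a s : reduced (a :: s) -> consr a s = a :: s.
Proof. by case: s => //= b s /andP[/negbTE-> _]. Qed.

Lemma consrK a s : reduced s -> consr (invl a) (consr a s) = s.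
Proof.
case: s => [|b s] Hs /=; first by rewrite invlK eqxx.
case: eqP => [eb | _] /=; last by rewrite invlK eqxx.
by rewrite -eb consr_id.
Qed.

Lemma catr_consr a s t : reduced s -> reduced t ->
  catr (consr a s) t = consr a (catr s t).
Proof.
case: s => [|b s] Hs Ht //=; case: eqP => [-> | //].
by have := consrK (invl a) (catr_reduced s Ht); rewrite invlK => ->.
Qed.

Lemma catrA s t u : reduced t -> reduced u ->
  catr s (catr t u) = catr (catr s t) u.
Proof.
move=> Ht Hu; elim: s => //= a s ->.
by rewrite -catr_consr // catr_reduced.
Qed.

Lemma catr0 s : reduced s -> catr s [::] = s.
Proof.
by elim: s => //= a s IHs Hs; rewrite IHs ?consr_id ?(reduced_cons Hs).
Qed.

Definition invs s : seq letter := rev (map invl s).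

Lemma invs_reduced s : reduced s -> reduced (invs s).
Proof.
rewrite /reduced /invs rev_sorted sorted_map; apply: sub_sorted => a b /=.
by rewrite invlK eq_sym.
Qed.

Lemma catr_invs s t : reduced t -> catr (invs s) (catr s t) = t.
Proof.
rewrite /invs; elim: s t => //= a s IHs t Ht.
rewrite rev_cons -cats1 {1}/catr foldr_cat /= -/(catr _ _) consrK ?IHs //.
exact: catr_reduced.
Qed.

Lemma invsK : involutive invs.
Proof.
by move=> s; rewrite /invs map_rev revK -map_comp (eq_map invlK) map_id.
Qed.

Definition fg_one : freeGroup := @FreeGroup [::] isT.

Definition fg_mul (u v : freeGroup) : freeGroup :=
  FreeGroup (catr_reduced u (valP v)).

Definition fg_inv (u : freeGroup) : freeGroup :=
  FreeGroup (invs_reduced (valP u)).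

Lemma fg_mulA : associative fg_mul.
Proof. by move=> u v w; apply/val_inj/catrA; apply: valP. Qed.

Lemma fg_mul1g : left_id fg_one fg_mul.
Proof. by move=> u; apply/val_inj. Qed.

Lemma fg_mulg1 : right_id fg_one fg_mul.
Proof. by move=> u; apply/val_inj/catr0/valP. Qed.

Lemma fg_mulVg : left_inverse fg_one fg_inv fg_mul.
Proof.
move=> u; apply/val_inj; rewrite /= -[X in catr _ X]catr0 ?catr_invs //.
exact: valP.
Qed.

Lemma fg_mulgV : right_inverse fg_one fg_inv fg_mul.
Proof.
move=> u; rewrite -[X in fg_mul X _](_ : fg_inv (fg_inv u) = u) ?fg_mulVg //.
by apply/val_inj; rewrite /= invsK.
Qed.

HB.instance Definition _ := isGroup.Build freeGroup
  fg_mulA fg_mul1g fg_mulg1 fg_mulVg fg_mulgV.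

Definition fg_gen (i : 'I_r) : freeGroup := @FreeGroup [:: (i, true)] isT.

Definition positive_word (w : freeGroup) : Prop :=
  exists s : seq 'I_r, w = (\prod_(i <- s) fg_gen i)%g.

Definition potentially_positive (w : freeGroup) : Prop :=
  exists phi : {multiplicative freeGroup -> freeGroup},
    bijective phi /\ positive_word (phi w).

Definition num_potentially_positive (n : nat) : nat :=
  #|[set t : n.-tuple letter |
      `[< exists w : freeGroup, potentially_positive w /\ word w = t >] ]|.

End FreeGroup.

Local Open Scope ring_scope.

Section Asymptotics.
Variable R : realType.
Implicit Types f g : nat -> R.

Definition is_bigO f g : Prop :=
  exists (C : R) (m : nat), forall n : nat, (m <= n)%N -> C * g n > f n.

Definition is_bigOmega f g : Prop := is_bigO g f.

Definition is_bigTheta f g : Prop := is_bigO f g /\ is_bigOmega f g.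

End Asymptotics.

Definition largest_root (R : realType) (p : {poly R}) (x : R) : Prop :=
  root p x /\ (forall y : R, root p y -> y <= x).

(* Main.v *)
Require Import Defs.
From HB Require Import structures.
From mathcomp Require Import all_boot all_order all_algebra.
From mathcomp Require Import zify ring lra.
From mathcomp Require Import boolp reals.

(* Up to conjugation, a basis of F_2 arises from a pair of signed letters by
   steps (u, v) -> (u, u v), by swaps, and by inverting both or one of its
   elements (Nielsen, with conjugation allowed as a length-reducing move).  So a
   potentially positive element is, up to conjugation, inversion and signed
   permutation of the letters, the image of a word in x, Y (capitals denote
   inverses) under a composition of x -> x, y -> x y and x -> x y, y -> y.  Such
   images contain neither yX nor Xy and, for some k > 0, have gaps i >= k in
   factors y x^i y and i >= -(k+1) in factors Y x^i Y.

   When factors y x^i y are excluded altogether, these words are counted by a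
   finite automaton with growth rate lambda_1, and, provided they start with Y,
   they are all potentially positive: this is the lower bound.  For the upper
   bound, let k be the least gap in a factor y x^i y.  The growth rate drops to
   lambda_1 (1 - q_k) with q_k ~ lambda_1^-k, and cutting at the gap bounds the
   number of words by O(n q_k (1 - q_k)^n lambda_1^n); since q_k decreases
   geometrically, the sum over k telescopes to O(lambda_1^n).  The remaining
   conjugations a c a^-1 cost only a convergent factor sum_j (4 / lambda_1^2)^j. *)

Set Implicit Arguments.
Unset Strict Implicit.
Unset Printing Implicit Defensive.

Import Order.TTheory GRing.Theory Num.Theory.

(** * Words and group elements *)

Section Words.
Variable r : nat.
Local Notation letter := ('I_r * bool)%type.
Local Notation F := (freeGroup r).
Implicit Types (a b z : letter) (s t u m : seq letter) (g h : F).

Lemma invl_neq a : a != invl a.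
Proof. by case: a => i []; rewrite /invl xpair_eqE eqxx. Qed.

Lemma invs_cat s t : invs (s ++ t) = invs t ++ invs s.
Proof. by rewrite /invs map_cat rev_cat. Qed.

Lemma invs_rcons s a : invs (rcons s a) = invl a :: invs s.
Proof. by rewrite -cats1 invs_cat. Qed.

Lemma invs_cons a s : invs (a :: s) = rcons (invs s) (invl a).
Proof. by rewrite /invs /= rev_cons. Qed.

Lemma size_invs s : size (invs s) = size s.
Proof. by rewrite size_rev size_map. Qed.

Lemma reduced_catE s z b t : reduced (rcons s z ++ b :: t) =
  [&& reduced (rcons s z), b != invl z & reduced (b :: t)].
Proof.
case: s => [|c s] //=.
by rewrite /reduced /= cat_path last_rcons /=.
Qed.

Lemma reduced_catl s t : reduced (s ++ t) -> reduced s.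
Proof. by rewrite /reduced => /cat_sorted2[]. Qed.

Lemma reduced_catr s t : reduced (s ++ t) -> reduced t.
Proof. by rewrite /reduced => /cat_sorted2[]. Qed.

Lemma reduced_glue s m t : m != [::] ->
  reduced (s ++ m) -> reduced (m ++ t) -> reduced (s ++ m ++ t).
Proof.
case/lastP: s => [|s z] //; case: m => [|a m] // _.
by rewrite cat_cons !reduced_catE => /and3P[-> -> _] ->.
Qed.

Lemma reduced_invs s : reduced (invs s) = reduced s.
Proof. by apply/idP/idP => [/invs_reduced|]; rewrite ?invsK //; apply: invs_reduced. Qed.

Lemma catr_id s t : reduced (s ++ t) -> catr s t = s ++ t.
Proof.
elim: s => //= a s IHs Hs; rewrite IHs ?consr_id //.
exact: reduced_cons Hs.
Qed.

Lemma catr_cancel s t : reduced s -> reduced t ->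
  exists a b c : seq letter,
  [/\ s = a ++ c, t = invs c ++ b, reduced (a ++ b) & catr s t = a ++ b].
Proof.
elim/last_ind: s t => [|s z IHs] t Hs Ht; first by exists [::], t, [::].
case: t Ht => [|b t] Ht.
  by exists (rcons s z), [::], [::]; rewrite !cats0 catr_id ?cats0.
have [eb|neb] := eqVneq b (invl z).
  have Hs' : reduced s by move: Hs; rewrite -cats1 => /reduced_catl.
  have [a1 [b1 [c1 [es et Hr e]]]] := IHs t Hs' (reduced_cons Ht).
  exists a1, b1, (rcons c1 z); split=> //.
  - by rewrite es -!cats1 catA.
  - by rewrite et invs_rcons eb.
  - rewrite -e /catr -cats1 foldr_cat /=; congr foldr.
    by rewrite eb eqxx.
exists (rcons s z), (b :: t), [::]; rewrite cats0.
have Hr : reduced (rcons s z ++ b :: t) by rewrite reduced_catE Hs neb.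
by split=> //; rewrite catr_id.
Qed.

Definition len g := size (word g).

Lemma word_inj g h : word g = word h -> g = h.
Proof. by move=> e; apply: val_inj. Qed.

Lemma wordP g : reduced (word g).
Proof. exact: valP. Qed.

Lemma wordM g h : word (g * h)%g = catr (word g) (word h).
Proof. by []. Qed.

Lemma wordV g : word (g^-1)%g = invs (word g).
Proof. by []. Qed.

Lemma lenV g : len (g^-1)%g = len g.
Proof. by rewrite /len wordV size_invs. Qed.

Lemma len_eq0 g : (len g == 0) = (g == 1%g).
Proof.
apply/idP/eqP => [|->] //; rewrite size_eq0 => /eqP e.
exact: word_inj.
Qed.

Lemma mul_cancel g h : exists a b c : seq letter,
  [/\ word g = a ++ c, word h = invs c ++ b & word (g * h)%g = a ++ b].
Proof.
have [a [b [c [? ? _ ?]]]] := catr_cancel (wordP g) (wordP h).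
by exists a, b, c.
Qed.

Definition gl a : F := @FreeGroup r [:: a] isT.

Definition elem s : F := (\prod_(a <- s) gl a)%g.

Lemma elem0 : elem [::] = 1%g.
Proof. by rewrite /elem big_nil. Qed.

Lemma elem_cat s t : elem (s ++ t) = (elem s * elem t)%g.
Proof. by rewrite /elem big_cat. Qed.

Lemma elem_cons a s : elem (a :: s) = (gl a * elem s)%g.
Proof. by rewrite /elem big_cons. Qed.

Lemma elem1 a : elem [:: a] = gl a.
Proof. by rewrite /elem big_seq1. Qed.

Lemma word_elem s : reduced s -> word (elem s) = s.
Proof.
elim: s => [|a s IHs] Hs; first by rewrite elem0.
by rewrite elem_cons wordM IHs ?(reduced_cons Hs) //= consr_id.
Qed.

Lemma elem_word g : elem (word g) = g.
Proof. by apply: word_inj; rewrite word_elem ?wordP. Qed.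

Lemma gl_inv a : gl (invl a) = (gl a)^-1%g.
Proof. exact: word_inj. Qed.

Lemma elem_invs s : elem (invs s) = (elem s)^-1%g.
Proof.
elim: s => [|a s IHs]; first by rewrite elem0 invg1.
by rewrite invs_cons -cats1 elem_cat elem1 elem_cons IHs gl_inv invgM.
Qed.

Lemma cyclic_reduction s : reduced s ->
  exists a c : seq letter,
  [/\ s = a ++ c ++ invs a, reduced (c ++ c) & s != [::] -> c != [::]].
Proof.
move: {2}(size s) (leqnn (size s)) => n; elim: n s => [|n IHn] s Hn Hs.
  by exists [::], [::]; case: s Hn Hs.
case: s Hn Hs => [|x s] Hn Hs; first by exists [::], [::].
case/lastP: s Hn Hs => [|s z] Hn Hs.
  exists [::], [:: x]; split=> //=.
  by rewrite /reduced /= invl_neq.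
have [ez|nez] := eqVneq z (invl x); last first.
  exists [::], (x :: rcons s z); split=> //; first by rewrite cats0.
  have := reduced_catE (x :: s) z x (rcons s z); rewrite rcons_cons => ->.
  rewrite Hs andbT /=; apply/eqP => ex.
  by rewrite ex invlK eqxx in nez.
have Hs' : reduced s.
  by move: Hs; rewrite -cats1 -cat1s => /reduced_catr /reduced_catl.
have [|a [c [es Hc Hne]]] := IHn s _ Hs'.
  by move: Hn => /=; rewrite size_rcons; lia.
have s0 : s != [::].
  by apply/eqP => e; move: Hs; rewrite e ez /reduced /= eqxx.
exists (x :: a), c; split => [||_]; rewrite ?Hne //.
by rewrite ez invs_cons es -!cats1 /= -!catA.
Qed.

(** With [g] = a c a^-1 and c cyclically reduced, a c c a^-1 is reduced and longer by |c|. Hence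
    less than half of [g] cancels in [g * g]. *)
Lemma len_sqr g : g != 1%g -> len g < len (g * g)%g.
Proof.
move=> g1; have [a [c [e Hc Hne]]] := cyclic_reduction (wordP g).
have c0 : c != [::] by apply: Hne; rewrite -size_eq0 len_eq0.
have He := wordP g; rewrite e in He.
have eg : g = (elem a * elem c * (elem a)^-1)%g.
  by rewrite -[LHS]elem_word e !elem_cat elem_invs mulgA.
have egg : (g * g = elem (a ++ (c ++ (c ++ invs a))))%g.
  by rewrite !elem_cat elem_invs eg !mulgA mulgVK.
rewrite /len egg word_elem.
  by rewrite e !size_cat; case: (c) c0 => //= *; lia.
apply: reduced_glue => //.
  by rewrite catA in He; exact: reduced_catl He.
rewrite catA; have := @reduced_glue c c (invs a) c0 Hc.
by rewrite catA; apply; exact: reduced_catr He.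
Qed.

End Words.

(** * Nielsen's theorem in rank two *)

Local Notation F2 := (freeGroup 2).
Local Notation letter := ('I_2 * bool)%type.

Section Nielsen.
Implicit Types (u v w g h : F2) (a b d : letter) (s t : seq letter).

Lemma len_elem s : len (elem s) <= size s.
Proof.
elim: s => [|a s IHs]; first by rewrite elem0.
rewrite elem_cons /len wordM /=; move: IHs; rewrite /len.
by case: (word (elem s)) => [|b t] //=; case: eqP => //= _; lia.
Qed.

(** No rule inverts one element alone. This keeps positive words in the pair positive in signed
    letters, up to inversion and conjugation; [nielsen_pair] supplies the missing inversion. *)
Inductive tree_pair : F2 -> F2 -> Prop :=
| tree_letters a b : a.1 != b.1 -> tree_pair (gl a) (gl b)
| tree_conj u v h : tree_pair u v -> tree_pair (u ^ h)%g (v ^ h)%g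
| tree_swap u v : tree_pair u v -> tree_pair v u
| tree_inv u v : tree_pair u v -> tree_pair u^-1%g v^-1%g
| tree_mul u v : tree_pair u v -> tree_pair u (u * v)%g.

Definition nielsen_pair u v := tree_pair u v \/ tree_pair u v^-1%g.

Lemma nielsen_swap u v : nielsen_pair u v -> nielsen_pair v u.
Proof.
case=> [/tree_swap|/tree_swap/tree_inv]; first by left.
by rewrite invgK; right.
Qed.

Lemma nielsen_inv u v : nielsen_pair u v -> nielsen_pair u v^-1%g.
Proof. by case=> H; [right; rewrite invgK | left]. Qed.

Lemma nielsen_invl u v : nielsen_pair u v -> nielsen_pair u^-1%g v.
Proof. by move/nielsen_swap/nielsen_inv/nielsen_swap. Qed.

Lemma nielsen_conj u v h : nielsen_pair u v -> nielsen_pair (u ^ h)%g (v ^ h)%g.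
Proof. by case=> /(tree_conj h); rewrite ?conjVg; [left|right]. Qed.

(** When only [tree_pair u v^-1] is known, multiplying by [v] is a division. After a multiplication
    step one quotient leads back, up to inversion and conjugation, to the previous pair, the other
    to the pair multiplied on the other side; at letters, division multiplies by an inverse
    letter. *)
Lemma tree_div u w : tree_pair u w ->
  nielsen_pair u (u / w)%g /\ nielsen_pair w (w / u)%g.
Proof.
elim=> {u w} [a b ab|u v h _ [H1 H2]|u v _ [H1 H2]|u v _ [H1 H2]|u v H [H1 H2]].
- rewrite -!gl_inv; split; left; apply: tree_mul; apply: tree_letters => //.
  by rewrite eq_sym.
- by split; rewrite -conjVg -conjMg; apply: nielsen_conj.
- by [].
- split.
    have /nielsen_inv/nielsen_invl/(nielsen_conj u) := H1.
    by rewrite !conjgE mulVg mulg1 invgM !invgK !mulgA mulgVK.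
  have /nielsen_inv/nielsen_invl/(nielsen_conj v) := H2.
  by rewrite !conjgE mulVg mulg1 invgM !invgK !mulgA mulgVK.
- split.
    rewrite invgM mulgA; right; have /(tree_conj u^-1%g) := H.
    by rewrite !conjgE !invgK !invgM !invgK !mulgA mulgK.
  left; have := tree_swap (tree_mul (tree_swap H)) => /(tree_conj u^-1%g).
  by rewrite !conjgE invgK !mulgA mulgK.
Qed.

Lemma nielsen_mul u v : nielsen_pair u v -> nielsen_pair u (u * v)%g.
Proof.
case=> [H|/tree_div[H _]]; first by left; apply: tree_mul.
by rewrite invgK in H.
Qed.

Lemma nielsen_mulr u v : nielsen_pair u v -> nielsen_pair u (v * u)%g.
Proof.
by move/nielsen_mul/(nielsen_conj u); rewrite !conjgE !mulgA mulVg !mul1g.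
Qed.

Definition basis_letter u v a : F2 :=
  let g := if a.1 == ord0 then u else v in if a.2 then g else g^-1%g.

Definition eval u v s : F2 := (\prod_(a <- s) basis_letter u v a)%g.

Lemma pick_inv u v a : basis_letter u v (invl a) = (basis_letter u v a)^-1%g.
Proof. by rewrite /basis_letter /=; case: a.2 => //=; rewrite invgK. Qed.

Lemma eval0 u v : eval u v [::] = 1%g.
Proof. by rewrite /eval big_nil. Qed.

Lemma eval_cons u v a s : eval u v (a :: s) = (basis_letter u v a * eval u v s)%g.
Proof. by rewrite /eval big_cons. Qed.

Lemma eval_cat u v s t : eval u v (s ++ t) = (eval u v s * eval u v t)%g.
Proof. by rewrite /eval big_cat. Qed.

Lemma eval_consr u v a s : eval u v (consr a s) = (basis_letter u v a * eval u v s)%g.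
Proof.
case: s => [|b s] /=; first by rewrite eval_cons.
case: eqP => [->|_]; rewrite ?eval_cons // pick_inv mulgA mulgV mul1g //.
Qed.

Lemma eval_catr u v s t : eval u v (catr s t) = (eval u v s * eval u v t)%g.
Proof.
elim: s => [|a s IHs] /=; first by rewrite eval0 mul1g.
by rewrite eval_consr IHs eval_cons mulgA.
Qed.

Lemma eval_invs u v s : eval u v (invs s) = (eval u v s)^-1%g.
Proof.
elim: s => [|a s IHs]; first by rewrite eval0 invg1.
by rewrite invs_cons -cats1 eval_cat !eval_cons eval0 mulg1 IHs pick_inv invgM.
Qed.

Definition generates u v := forall P : F2 -> Prop, P 1%g ->
  (forall g h, P g -> P h -> P (g * h)%g) -> (forall g, P g -> P g^-1%g) ->
  P u -> P v -> forall g, P g.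

Lemma generates_eval u v g : generates u v -> exists2 s, reduced s & g = eval u v s.
Proof.
move=> H; apply: (H (fun g => exists2 s, reduced s & g = eval u v s)).
- by exists [::]; rewrite ?eval0.
- move=> g1 g2 [s Hs ->] [t Ht ->]; exists (catr s t); rewrite ?eval_catr //.
  exact: catr_reduced.
- by move=> g1 [s Hs ->]; exists (invs s); rewrite ?reduced_invs ?eval_invs.
- by exists [:: (ord0, true)] => //; rewrite eval_cons eval0 mulg1.
- by exists [:: (ord_max, true)] => //; rewrite eval_cons eval0 mulg1.
Qed.

Lemma generates_swap u v : generates u v -> generates v u.
Proof. by move=> H P P1 PM PV Pv Pu; apply: H. Qed.

Lemma generates_mulr u v : generates u v -> generates (u * v)%g v.
Proof.
move=> H P P1 PM PV Puv Pv; apply: H => //.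
by rewrite -[u](mulgK v); apply: PM => //; apply: PV.
Qed.

Lemma generates_conj h u v : generates u v -> generates (u ^ h)%g (v ^ h)%g.
Proof.
move=> H P P1 PM PV Pu Pv g; rewrite -[g](conjgKV h).
move: (g ^ h^-1)%g; apply: H => //=.
- by rewrite conj1g.
- by move=> g1 g2 ? ?; rewrite conjMg; apply: PM.
- by move=> g1 ?; rewrite conjVg; apply: PV.
Qed.

(** If [u] were trivial, [v] would be central, then so would every element, but the two letters do
    not commute. *)
Lemma generates_neq1 u v : generates u v -> u != 1%g.
Proof.
move=> H; apply/eqP => u1; rewrite {u}u1 in H.
have c1 g : (g * v = v * g)%g.
  move: g; apply: H => //.
  - by rewrite mul1g mulg1.
  - by move=> g h Hg Hh; rewrite -mulgA Hh mulgA Hg mulgA.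
  - by move=> g Hg; apply: (mulgI g); rewrite mulVKg mulgA Hg mulgK.
  - by rewrite mul1g mulg1.
have c2 g : forall h, (g * h = h * g)%g.
  move: g; apply: H => //.
  - by move=> h; rewrite mul1g mulg1.
  - by move=> g1 g2 H1 H2 h; rewrite -mulgA (H2 h) mulgA (H1 h) mulgA.
  - by move=> g Hg h; apply: (mulgI g); rewrite mulVKg mulgA Hg mulgK.
  - by move=> h; rewrite mul1g mulg1.
have E := c2 (gl (ord0, true)) (gl (ord_max, true)).
by move: (congr1 (@word 2) E) => /eqP.
Qed.

Definition cancelled g h := (len g + len h - len (g * h)%g)./2.

Lemma cancelledP g h : exists a b c : seq letter,
  [/\ word g = a ++ c, word h = invs c ++ b, word (g * h)%g = a ++ b
    & cancelled g h = size c].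
Proof.
have [a [b [c [e1 e2 e3]]]] := mul_cancel g h.
exists a, b, c; split=> //.
by rewrite /cancelled /len e1 e2 e3 !size_cat size_invs; lia.
Qed.

(* The hypothesis says that in a reduced product of factors u^{+-1}, v^{+-1} no
   factor is absorbed by its two neighbours together. *)
Section Strict.
Variables u v : F2.
Local Notation e := (basis_letter u v).
Hypothesis H : forall a b d, b != invl a -> d != invl b ->
  cancelled (e a) (e b) + cancelled (e b) (e d) < len (e b).

(** After cancellation with what follows, a prefix of [e a] survives that no preceding factor can
    absorb, by [H]. So each factor adds at least one letter to the length. *)
Lemma eval_strict a s : reduced (a :: s) -> exists k t,
  [/\ word (eval u v (a :: s)) = take (len (e a) - k) (word (e a)) ++ t,
      forall b, a != invl b -> cancelled (e b) (e a) + k < len (e a)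
    & size s <= size t].
Proof.
elim: s a => [|b s IHs] a Hs.
  exists 0, [::]; rewrite eval_cons eval0 mulg1 subn0 take_size cats0; split=> //.
  by move=> b Hb; have := H Hb (invl_neq a); lia.
have [|k [t [Ht Hk Hsz]]] := IHs b; first exact: reduced_cons Hs.
have ba : b != invl a by move: Hs => /= /andP[].
have [A [B [c [ea eb eab ec]]]] := cancelledP (e a) (e b).
have := Hk _ ba; rewrite ec => Hc.
exists (size c), (take (len (e b) - k - size c) B ++ t); split.
- have Hb' : reduced (word (eval u v (b :: s))) by apply: wordP.
  (* [B'] is what remains of [e b] after cancellation on both sides; being nonempty, it allows
     [reduced_glue]. *)
  set B' := take _ B; have B'0 : B' != [::].
    have : len (e b) = size c + size B by rewrite /len eb size_cat size_invs.
    have := size_take (len (e b) - k - size c) B; rewrite -size_eq0 -/B'.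
    case: (ltnP (len (e b) - k - size c) (size B)) => ? E1 ?;
      by rewrite -lt0n E1; clear B' E1; lia.
  have Et : word (eval u v (b :: s)) = invs c ++ (B' ++ t).
    rewrite Ht eb take_cat size_invs.
    case: (ltnP (len (e b) - k) (size c)) => *; first by lia.
    by rewrite -catA.
  have Hr : reduced (A ++ B' ++ t).
    apply: reduced_glue => //; last by rewrite Et in Hb'; exact: reduced_catr Hb'.
    have := wordP (e a * e b)%g.
    rewrite eab /B' -{1}[B](cat_take_drop (len (e b) - k - size c)).
    by rewrite catA => /reduced_catl.
  have -> : take (len (e a) - size c) (word (e a)) = A.
    by rewrite /len ea size_cat addnK take_size_cat.
  rewrite eval_cons -[e a]elem_word ea -[eval _ _ (b :: s)]elem_word Et.
  by rewrite 2!(elem_cat _ c, elem_cat (invs c)) elem_invs mulgA mulgK -elem_cat word_elem.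
- move=> d Hd; rewrite -ec; exact: H.
- have : len (e b) = size c + size B by rewrite /len eb size_cat size_invs.
  rewrite /= size_cat size_take.
  by case: (ltnP (len (e b) - k - size c) (size B)) => *; lia.
Qed.

Lemma len_ev_strict s : reduced s -> size s <= len (eval u v s).
Proof.
case: s => [|a s] // Hs; have [k [t [Hw Hk Hsz]]] := eval_strict Hs.
(* Taking the preceding letter equal to [a] shows that part of [e a] survives. *)
have Ha : a != invl (invl (invl a)) by rewrite invlK invl_neq.
have := Hk (invl (invl a)) Ha => Hlt.
by rewrite /len Hw size_cat size_take_min -/(len _) /=; lia.
Qed.
End Strict.

Lemma ord2_neq (i j : 'I_2) : i != j -> (i == ord0) = (j != ord0).
Proof. by case: i j => [[|[|]] ?] // [[|[|]] ?]. Qed.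

Lemma nielsen_basis_letter u v a b : a.1 != b.1 ->
  nielsen_pair (basis_letter u v a) (basis_letter u v b) -> nielsen_pair u v.
Proof.
have Vl g h : nielsen_pair g^-1%g h -> nielsen_pair g h by move=> /nielsen_invl; rewrite invgK.
have Vr g h : nielsen_pair g h^-1%g -> nielsen_pair g h by move=> /nielsen_inv; rewrite invgK.
move=> /ord2_neq; rewrite /basis_letter; case: eqP; case: eqP => // _ _ _;
case: a.2; case: b.2 => H; by [exact: H | exact: Vl | exact: Vr
  | exact: Vl (Vr _ _ H) | exact: Vr (Vl _ _ H) | exact/nielsen_swap/H
  | exact/nielsen_swap/Vl | exact/nielsen_swap/Vr | exact/nielsen_swap/Vl/Vr].
Qed.

Lemma generates_basis_letter u v a b : a.1 != b.1 -> generates u v ->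
  generates (basis_letter u v a) (basis_letter u v b).
Proof.
move=> /ord2_neq ab H P P1 PM PV Pa Pb; have PV' g : P g^-1%g -> P g.
  by move=> /PV; rewrite invgK.
move: ab Pa Pb; rewrite /basis_letter; case: eqP; case: eqP => // _ _ _;
case: a.2; case: b.2 => Pa Pb; apply: H => //; exact: PV'.
Qed.

Lemma len_basis_letter u v a :
  len (basis_letter u v a) = if a.1 == ord0 then len u else len v.
Proof. by rewrite /basis_letter; case: eqP; case: a.2 => _; rewrite ?lenV. Qed.

(** Induction on the total length. A pair that no product or conjugation shortens satisfies the
    hypothesis of [len_ev_strict], so each generator, having length one, is a single [basis_letter]
    and the pair consists of signed letters. *)
Lemma generates_nielsen u v : generates u v -> nielsen_pair u v.
Proof.
move: {2}(len u + len v) (leqnn (len u + len v)) => n.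
elim: n u v => [|n IHn] u v Hn Huv.
  have := generates_neq1 Huv; rewrite -len_eq0; lia.
have Hlen a b : a.1 != b.1 ->
    len (basis_letter u v a) + len (basis_letter u v b) = len u + len v.
  move=> /ord2_neq; rewrite !len_basis_letter; case: eqP; case: eqP => //; lia.
have short p q : generates p q -> len p + len q <= n.+1 ->
    len (p * q)%g < len p -> nielsen_pair p q.
  move=> Hpq Hs Hlt; have /nielsen_swap/nielsen_invl/nielsen_mulr : nielsen_pair (p * q)%g q.
    by apply: IHn; [lia | apply: generates_mulr].
  by rewrite mulgK => /nielsen_invl; rewrite invgK => /nielsen_swap.
pose red1 a b := (a.1 != b.1) ==>
  (len (basis_letter u v a) <= len (basis_letter u v a * basis_letter u v b)%g).
have [/forallP R1|] := boolP [forall a, forall b, red1 a b]; last first.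
  rewrite negb_forall => /existsP[a]; rewrite negb_forall => /existsP[b].
  rewrite negb_imply -ltnNge => /andP[ab Hlt]; apply: (nielsen_basis_letter ab).
  by apply: short Hlt; rewrite ?Hlen //; apply: generates_basis_letter.
have {}R1 a b : a.1 != b.1 ->
    len (basis_letter u v a) <= len (basis_letter u v a * basis_letter u v b)%g.
  by have /forallP/(_ b)/implyP := R1 a.
have R2 a b : a.1 != b.1 ->
    len (basis_letter u v b) <= len (basis_letter u v a * basis_letter u v b)%g.
  move=> ab; rewrite -(lenV (basis_letter u v b)) -(lenV (_ * _)%g) invgM -!pick_inv.
  by apply: R1; rewrite eq_sym.
(* Products are no shorter than either factor, so at most half of each factor cancels. *)
have half a b : a.1 != b.1 ->
    2 * cancelled (basis_letter u v a) (basis_letter u v b) <= len (basis_letter u v b)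
    /\ 2 * cancelled (basis_letter u v a) (basis_letter u v b) <= len (basis_letter u v a).
  by move=> ab; have := R1 _ _ ab; have := R2 _ _ ab; rewrite /cancelled; lia.
have neq1 b : 0 < len (basis_letter u v b).
  have := generates_neq1 Huv; have := generates_neq1 (generates_swap Huv).
  by rewrite len_basis_letter -!len_eq0; case: (b.1 == ord0); lia.
have self b : 2 * cancelled (basis_letter u v b) (basis_letter u v b) < len (basis_letter u v b).
  have b0 := neq1 b; have := b0; rewrite lt0n len_eq0 => /len_sqr; rewrite /cancelled; lia.
have [/existsP[a /existsP[b /andP[ab Hge]]]|] := boolP [exists a, exists b,
    (a.1 != b.1) && (len (basis_letter u v b) <=
     cancelled (basis_letter u v a) (basis_letter u v b) +
     cancelled (basis_letter u v b) (basis_letter u v a))].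
  have ba : b.1 != a.1 by rewrite eq_sym.
  apply: (nielsen_basis_letter ba).
  have := generates_basis_letter ba Huv; have := Hlen _ _ ba.
  have := half _ _ ab; have := half _ _ ba; have := neq1 b; move: Hge.
  move: (basis_letter u v a) (basis_letter u v b) => o q Hge q0 [h1 h2] [h3 h4] Hs Hg.
  have [A1 [B1 [c1 [eo eq _ ec1]]]] := cancelledP o q.
  have [A2 [B2 [c2 [eq' eo' _ ec2]]]] := cancelledP q o.
  (* By [half], absorbing all of [q] means that exactly half of it cancels on each side. *)
  have lq : len q = size c1 + size c2 by lia.
  have lq1 : len q = size c1 + size B1 by rewrite /len eq size_cat size_invs.
  have lo : len o = size c2 + size B2 by rewrite /len eo' size_cat size_invs.
  have lo1 : len o = size A1 + size c1 by rewrite /len eo size_cat.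
  have sz : size (invs c1) = size A2.
    by rewrite size_invs; move: lq; rewrite /len eq' size_cat; lia.
  have /eqP := etrans (esym eq) eq'; rewrite eqseq_cat // => /andP[_ /eqP eB1].
  rewrite {}eB1 in eq lq1.
  have eA1 : A1 = invs c2 ++ drop (size c2) A1.
    rewrite -{1}[A1](cat_take_drop (size c2)); congr (_ ++ _).
    have := congr1 (take (size c2)) (etrans (esym eo) eo').
    rewrite take_cat -{4}(size_invs c2) take_size_cat //.
    case: ltnP => //; rewrite leq_eqVlt => /orP[/eqP e|]; last by lia.
    by rewrite -e subnn take0 cats0 take_size.
  (* Here q = s t and o = t^-1 m s^-1, so conjugating (q, q o) by s gives the
     shorter pair (t s, m). *)
  set m := drop _ _ in eA1.
  have sm : size m = size A1 - size c2 by rewrite size_drop.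
  set S := elem (invs c1); set T := elem c2; set M := elem m.
  have q_ST : q = (S * T)%g by rewrite -[q]elem_word eq elem_cat.
  have o_TMS : o = (T^-1 * M * S^-1)%g.
    by rewrite -[o]elem_word eo eA1 !elem_cat elem_invs /S elem_invs invgK.
  have qS : (q ^ S = T * S)%g by rewrite conjgE q_ST !mulgA mulVg mul1g.
  have oS : (o ^ S = (T * S)^-1 * M)%g.
    by rewrite conjgE o_TMS invgM !mulgA mulgVK.
  have H0 : nielsen_pair (T * S)%g M.
    apply: IHn.
      rewrite -elem_cat; have := len_elem (c2 ++ invs c1); have := len_elem m.
      rewrite -/M sm size_cat size_invs; move: (len _) (len M) => x y; lia.
    move: (@generates_conj S _ _ Hg); rewrite qS oS => H P P1 PM PV PTS PMM.
    by apply: H => //; apply: PM => //; apply: PV.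
  have /nielsen_invl/nielsen_mul/nielsen_invl := H0.
  rewrite invgK -oS -qS => /(nielsen_conj S^-1%g).
  by rewrite !conjgK.
rewrite negb_exists => /forallP N.
have {}N a b : a.1 != b.1 -> cancelled (basis_letter u v a) (basis_letter u v b) +
    cancelled (basis_letter u v b) (basis_letter u v a) < len (basis_letter u v b).
  move=> ab; have := N a; rewrite negb_exists => /forallP/(_ b).
  by rewrite ab /= -ltnNge.
have same a b : a.1 = b.1 -> b != invl a -> b = a.
  by case: a b => i [] [j []] /= <-; rewrite /invl ?eqxx.
have strict a b d : b != invl a -> d != invl b ->
    cancelled (basis_letter u v a) (basis_letter u v b) +
    cancelled (basis_letter u v b) (basis_letter u v d)
    < len (basis_letter u v b).
  move=> ba db; have Sb := self b.
  have [/same/(_ ba) e|ab] := eqVneq a.1 b.1.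
    rewrite -{}e in db Sb *.
    have [/same/(_ db) -> |bd] := eqVneq b.1 d.1; first by lia.
    by have [] := half _ _ bd; lia.
  have [h1 h2] := half _ _ ab.
  have [/same/(_ db) -> |bd] := eqVneq b.1 d.1; first by lia.
  have [h3 h4] := half _ _ bd.
  have [->|da] := eqVneq d a; first exact: N.
  have {}da : d = invl a.
    have eda : d.1 = a.1.
      move: ab bd; case: a.1 b.1 d.1 => [[|[|]] ?] // [[|[|]] ?] // [[|[|]] ?] // ? ?;
        exact: val_inj.
    apply/eqP/negPn/negP => dia; case/eqP: da; exact: same.
  rewrite {}da pick_inv in h3 h4 *.
  (* Here [q] stands between [o] and [o^-1]; if absorbed, it would have the form c^-1 c, which is
     not reduced. *)
  rewrite ltnNge; apply/negP => Hge; have := neq1 b.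
  move: (basis_letter u v a) (basis_letter u v b) h1 h2 h3 h4 Hge => o q h1 h2 h3 h4 Hge q0.
  have [A1 [B1 [c1 [eo eq _ ec1]]]] := cancelledP o q.
  have [A2 [B2 [c2 [eq' eo' _ ec2]]]] := cancelledP q o^-1%g.
  have lq : len q = size c1 + size c2 by lia.
  have sz : size (invs c1) = size A2.
    by rewrite size_invs; move: lq; rewrite /len eq' size_cat; lia.
  have /eqP := etrans (esym eq) eq'; rewrite eqseq_cat // => /andP[_ /eqP eB1].
  have : invs c2 ++ B2 == invs c1 ++ invs A1 by rewrite -eo' -invs_cat -eo.
  have sz' : size (invs c2) = size (invs c1) by rewrite !size_invs; lia.
  rewrite eqseq_cat // => /andP[/eqP/(can_inj (@invsK 2)) e12 _].
  have := wordP q; rewrite eq eB1 e12.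
  case: (c1) lq => [|z c]; first by rewrite e12 /=; lia.
  by rewrite invs_cons reduced_catE invlK eqxx andbF.
have gens x : exists a, gl x = basis_letter u v a.
  have [s Hs es] := generates_eval (gl x) Huv.
  have := len_ev_strict strict Hs; rewrite -es.
  case: s Hs es => [|a [|b s]] // Hs es _; last first.
    by exists a; rewrite es eval_cons eval0 mulg1.
  by have := congr1 (@len 2) es; rewrite eval0.
have [a ea] := gens (ord0, true); have [b eb] := gens (ord_max, true).
have ab : a.1 != b.1.
  apply/eqP => e; have [eab|/(same _ _ e)] := eqVneq b (invl a).
    by have := congr1 (@word 2) eb; rewrite eab pick_inv -ea.
  by move=> eab; have := congr1 (@word 2) eb; rewrite eab -ea.
apply: (nielsen_basis_letter ab); rewrite -ea -eb; left; exact: tree_letters.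
Qed.
End Nielsen.

(** * The automaton *)

Notation lx := ((ord0, true) : letter).
Notation lX := ((ord0, false) : letter).
Notation ly := ((ord_max, true) : letter).
Notation lY := ((ord_max, false) : letter).

Lemma letter_ind (P : letter -> Prop) : P lx -> P lX -> P ly -> P lY -> forall a, P a.
Proof.
move=> H1 H2 H3 H4 [[[|[|//]] Hi] b].
  by rewrite (_ : Ordinal Hi = ord0); [case: b | apply: val_inj].
by rewrite (_ : Ordinal Hi = ord_max); [case: b | apply: val_inj].
Qed.

(* The automaton rejects the factors yX and Xy.  Its states record the end of the
   word read so far: SX i is X^i, SY i is y x^i, SN is Y, SP is x^i not preceded
   by y, and S0 is the empty word.  The factor y x^i y is accepted when [cy i],
   and X^i may be followed by a further X when [cx i]. *)
Inductive state := S0 | SP | SN | SX of nat | SY of nat.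

Section Lang.
Variables (cy cx : pred nat).

Definition step (q : state) (a : letter) : option state :=
  match q, (a.1 == ord0, a.2) with
  | S0, (true, true) => Some SP
  | S0, (true, false) => Some (SX 1)
  | S0, (false, true) => Some (SY 0)
  | S0, (false, false) => Some SN
  | SP, (true, true) => Some SP
  | SP, (true, false) => None
  | SP, (false, true) => Some (SY 0)
  | SP, (false, false) => Some SN
  | SN, (true, true) => Some SP
  | SN, (true, false) => Some (SX 1)
  | SN, (false, true) => None
  | SN, (false, false) => Some SN
  | SX i, (true, false) => if cx i then Some (SX i.+1) else None
  | SX i, (false, false) => Some SN
  | SX i, (_, true) => None
  | SY i, (true, true) => Some (SY i.+1)
  | SY i, (true, false) => None
  | SY i, (false, true) => if cy i then Some (SY 0) else None
  | SY i, (false, false) => if 0 < i then Some SN else None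
  end.

Fixpoint run (q : state) (s : seq letter) : bool :=
  if s is a :: s' then if step q a is Some q' then run q' s' else false
  else true.

Lemma run_catl q s t : run q (s ++ t) -> run q s.
Proof. by elim: s q => //= a s IHs q; case: step => // q1; apply: IHs. Qed.

(* [dom q' q]: every word accepted from q is accepted from q'. *)
Definition dom (q' q : state) : bool :=
  match q', q with
  | S0, _ | SP, SP | SP, SY _ | SN, SN => true
  | SX i, SX j => i <= j
  | SY i, SY j => i == j
  | _, _ => false
  end.

Hypothesis cx_anti : forall i j, i <= j -> cx j -> cx i.

Lemma run_dom q q' s : dom q' q -> run q s -> run q' s.
Proof.
elim: s q q' => //= a s IHs q q'.
elim/letter_ind: a; case: q => [|||i|i]; case: q' => [|||j|j] //= Hd;
  try (by apply: IHs => //=); try (by move/eqP: Hd => <-);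
  try (by case: ifP => // _; apply: IHs).
- by case: ifP => // Hj; rewrite (cx_anti Hd Hj); apply: IHs.
Qed.

(** [S0] dominates every state, so a suffix can be read afresh. With [run_catl] the language from
    [S0] is closed under factors. *)
Lemma run_catr q s t : run q (s ++ t) -> run S0 t.
Proof.
elim: s q => [|a s IHs] q /=; first exact: run_dom.
by case: step => // q1; apply: IHs.
Qed.

Lemma run_reduced q s : run q s -> reduced s.
Proof.
elim: s q => //= a s IHs q; case Hq: step => [q1|] // Hr.
have {IHs} := IHs _ Hr; case: s Hr => //= b s Hr Hs; rewrite /reduced /= Hs andbT.
apply/eqP => e; move: Hq Hr; rewrite {}e.
by elim/letter_ind: a; case: q => [|||i|i] //=; do ?[case: ifP => // ?];
  case=> <- //=.
Qed.

End Lang.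

Lemma run_mono (cy cx cy' cx' : pred nat) q s :
  subpred cy cy' -> subpred cx cx' -> run cy cx q s -> run cy' cx' q s.
Proof.
move=> Hy Hx; elim: s q => //= a s IHs q.
elim/letter_ind: a; case: q => [|||i|i] //=; try exact: IHs.
- by case: ifP => // /Hx->; apply: IHs.
- by case: ifP => // /Hy->; apply: IHs.
- by case: ifP => // _; apply: IHs.
Qed.

(* The reduced image under x -> x, y -> xy of a word without Xy; the flag p
   delays the X of Y -> YX, which cancels against a following x. *)
Fixpoint lift_word (p : bool) (s : seq letter) : seq letter :=
  match s with
  | [::] => if p then [:: lX] else [::]
  | a :: s' =>
    match a.1 == ord0, a.2 with
    | true, true => if p then lift_word false s' else lx :: lift_word false s'
    | true, false => (if p then [:: lX] else [::]) ++ lX :: lift_word false s'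
    | false, true => (if p then [:: lX] else [::]) ++ [:: lx, ly & lift_word false s']
    | false, false => (if p then [:: lX] else [::]) ++ lY :: lift_word true s'
    end
  end.

Definition subst (u v : F2) (g : F2) : F2 := eval u v (word g).

Lemma substM u v : {morph subst u v : g h / (g * h)%g}.
Proof. by move=> g h; rewrite /subst wordM eval_catr. Qed.

Lemma subst1 u v : subst u v 1%g = 1%g.
Proof. exact: eval0. Qed.

Lemma subst_gl u v a : subst u v (gl a) = basis_letter u v a.
Proof. by rewrite /subst eval_cons eval0 mulg1. Qed.

Lemma subst_elem u v s : subst u v (elem s) = eval u v s.
Proof.
elim: s => [|a s IHs]; first by rewrite elem0 subst1 eval0.
by rewrite elem_cons substM IHs subst_gl eval_cons.
Qed.

Notation gx := (gl lx).
Notation gy := (gl ly).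

Definition sL := subst gx (gx * gy)%g.
Definition sR := subst (gx * gy)%g gy.
(** Exchanges x and Y. It conjugates [sL] into [sR], so that only [sL] has to be followed on
    words. *)
Definition sF := subst (gl lY) (gl lX).

Lemma elem_lift_word p s : elem (lift_word p s) =
  ((if p then gl lX else 1) * sL (elem s))%g.
Proof.
have EX : gl lX = (gx^-1)%g by apply: word_inj.
have EY : gl lY = (gy^-1)%g by apply: word_inj.
elim: s p => [|a s IHs] p.
  by rewrite elem0 /sL subst1 mulg1; case: p; rewrite /= ?elem0 ?elem1.
rewrite elem_cons {1}/sL substM subst_gl -/(sL _).
elim/letter_ind: a; case: p => /=; rewrite ?elem_cons IHs /basis_letter /= ?mul1g //.
- by rewrite EX mulKg.
all: by rewrite ?EX ?EY ?invgM -?mulgA ?mul1g.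
Qed.

(** Compares the state on a word with the state on its lift, [p] marking a pending X. As Yx lifts to
    Y, [SP] may face [SN]. *)
Definition lift_rel (q q' : state) (p : bool) : bool :=
  match q, q', p with
  | S0, S0, false | SN, SN, true | SP, SP, false | SP, SN, false => true
  | SX i, SX j, false => j <= i.+1
  | SY i, SY j, false => i == j
  | _, _, _ => false
  end.

(** The x emitted before each y enlarges every gap in y x^i y by one, and the X emitted after Y
    lengthens the following run of X by one. *)
Lemma run_lift_word (cy cx cy' cx' : pred nat) s q q' p :
  (forall i, cy i -> cy' i.+1) -> (forall i j, cx i -> j <= i.+1 -> cx' j) ->
  cx' 1 -> lift_rel q q' p -> run cy cx q s -> run cy' cx' q' (lift_word p s).
Proof.
move=> Hy Hx Hx1; elim: s q q' p => [|a s IHs] q q' p.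
  by case: q => [|||i|i]; case: q' => [|||j|j]; case: p => //=.
elim/letter_ind: a; case: q => [|||i|i]; case: q' => [|||j|j]; case: p => //=;
  try by [move=> _; apply: IHs]; try by [rewrite ?Hx1; apply: IHs].
all: try (by rewrite ?Hx1 => H; apply: IHs => //=).
all: try (by move=> Hj; case: ifP => // Hi; rewrite (Hx _ _ Hi Hj); apply: IHs).
all: try (by move=> /eqP <-; apply: IHs => /=).
all: try (by move=> /eqP <-; case: ifP => // /Hy ->; apply: IHs => /=).
all: try (by move=> /eqP <-; case: ifP => // _; apply: IHs => /=).
Qed.

Definition flip (a : letter) : letter :=
  (if a.1 == ord0 then ord_max else ord0, ~~ a.2).

Definition flip_rel (q q' : state) : bool :=
  match q, q' with
  | S0, S0 | SP, SN | SN, SP | SX _, SY 0 | SY 0, SX _ => true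
  | SN, SY i => 0 < i
  | SY i, SN => 0 < i
  | _, _ => false
  end.

(** Only the gap 0, that is yy, becomes a repeated X; y x^i y with i > 0 becomes X Y^i X. Conversely
    X Y^i X becomes y x^i y, so every gap must be allowed. *)
Lemma run_flip (cy cx cy' cx' : pred nat) s q q' :
  (forall i, cy' i) -> (forall j, cy 0 -> cx' j) ->
  flip_rel q q' -> run cy cx q s -> run cy' cx' q' (map flip s).
Proof.
move=> Hy Hx; elim: s q q' => //= a s IHs q q'.
elim/letter_ind: a; case: q => [|||i|[|i]]; case: q' => [|||j|[|j]] //= _;
  rewrite ?Hy;
  try by [apply: IHs | case: ifP => // /Hx->; apply: IHs | case: ifP => // _; apply: IHs].
Qed.

(** * Branches of the tree of bases *)

Definition hom (f : F2 -> F2) := {morph f : g h / (g * h)%g}.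

Lemma hom1 f : hom f -> f 1%g = 1%g.
Proof. by move=> H; apply: (mulgI (f 1%g)); rewrite -H !mulg1. Qed.

Lemma homV f g : hom f -> f (g^-1)%g = (f g)^-1%g.
Proof. by move=> H; apply: (mulgI (f g)); rewrite -H !mulgV hom1. Qed.

Lemma hom_basis_letter f u v a : hom f -> f (basis_letter u v a) = basis_letter (f u) (f v) a.
Proof. by move=> H; rewrite /basis_letter; case: eqP; case: a.2; rewrite ?homV. Qed.

Lemma hom_eval f u v s : hom f -> f (eval u v s) = eval (f u) (f v) s.
Proof.
move=> H; elim: s => [|a s IHs]; first by rewrite !eval0 hom1.
by rewrite !eval_cons H IHs hom_basis_letter.
Qed.

Lemma hom_subst f u v g : hom f -> f (subst u v g) = subst (f u) (f v) g.
Proof. exact: hom_eval. Qed.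

Lemma eval_gen s : eval gx gy s = elem s.
Proof.
elim: s => [|a s IHs]; first by rewrite eval0 elem0.
rewrite eval_cons elem_cons IHs; congr (_ * _)%g.
by elim/letter_ind: a; apply: word_inj.
Qed.

Lemma hom_gen f g : hom f -> f g = subst (f gx) (f gy) g.
Proof. by move=> H; rewrite -hom_subst // /subst eval_gen elem_word. Qed.

Lemma hom_sL : hom sL. Proof. exact: substM. Qed.
Lemma hom_sR : hom sR. Proof. exact: substM. Qed.
Lemma hom_sF : hom sF. Proof. exact: substM. Qed.

Lemma hom_comp f f' : hom f -> hom f' -> hom (fun g => f (f' g)).
Proof. by move=> H H' g h; rewrite /= H' H. Qed.

Lemma sF_elem s : sF (elem s) = elem (map flip s).
Proof.
elim: s => [|a s IHs]; first by rewrite /= elem0 (hom1 hom_sF).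
rewrite /= !elem_cons hom_sF IHs; congr (_ * _)%g; rewrite /sF subst_gl.
by elim/letter_ind: a; apply: word_inj.
Qed.

Lemma flipK : involutive flip.
Proof. by move=> a; elim/letter_ind: a. Qed.

Lemma sFK : involutive sF.
Proof.
by move=> g; rewrite -[g]elem_word !sF_elem -map_comp (eq_map flipK) map_id.
Qed.

Lemma sF_sL g : sF (sL g) = sR (sF g).
Proof.
rewrite [LHS](hom_gen _ (hom_comp hom_sF hom_sL)).
rewrite [RHS](hom_gen _ (hom_comp hom_sR hom_sF)).
congr subst; rewrite ?[sL (gl _)]subst_gl ?[sF (gl _)]subst_gl /basis_letter /=.
  by rewrite [sR (gl _)]subst_gl /basis_letter /=; apply: word_inj.
rewrite hom_sF ![sF (gl _)]subst_gl /basis_letter /= [sR (gl _)]subst_gl /basis_letter /=.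
exact: word_inj.
Qed.

Lemma sF_sR g : sF (sR g) = sL (sF g).
Proof. by rewrite -{1}[g]sFK -sF_sL sFK. Qed.

Definition branch (l : seq bool) (g : F2) : F2 :=
  foldr (fun b h => if b then sL h else sR h) g l.

Lemma hom_branch l : hom (branch l).
Proof.
elim: l => [|b l IHl] g h //=; rewrite IHl.
by case: b; [apply: hom_sL | apply: hom_sR].
Qed.

Lemma branch_rcons l b g : branch (rcons l b) g = branch l (if b then sL g else sR g).
Proof. by rewrite /branch foldr_rcons. Qed.

Lemma sF_branch l g : sF (branch l g) = branch (map negb l) (sF g).
Proof. by elim: l => [|[] l IHl] //=; rewrite ?sF_sL ?sF_sR IHl. Qed.

(* Gaps at least k in y x^i y, and runs of X of length at most k + 1. *)
Definition Phi k := run (fun i => k <= i) (fun i => i <= k) S0.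

(* [leading l] is the gap parameter k of the words on the branch l; it is positive
   when l starts with sL, and flip exchanges the two kinds of branches. *)
Fixpoint leading (l : seq bool) : nat := if l is true :: l' then (leading l').+1 else 0.

Definition over_xY (s : seq letter) := all (mem [:: lx; lY]) s.

Lemma over_xY_Phi k s : over_xY s -> Phi k s.
Proof.
have H q : match q with SP | SN | S0 => true | _ => false end -> over_xY s ->
    run (fun i => k <= i) (fun i => i <= k) q s.
  elim: s q => //= a s IHs q; rewrite /over_xY /= => Hq /andP[Ha Hs].
  have {}Hs : over_xY s by [].
  by elim/letter_ind: a Ha; case: q Hq => // _ _; apply: IHs.
exact: H.
Qed.

Lemma over_xY_flip s : over_xY s -> over_xY (map flip s).
Proof.
by rewrite /over_xY all_map; apply: sub_all => a; elim/letter_ind: a.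
Qed.

(** [sL] raises the parameter by one. For [sR], which is [sL] conjugated by [sF], lifting leaves no
    yy, so flipping back leaves no XX, and this is the parameter 0. *)
Lemma branch_over_xY l t : over_xY t ->
  exists2 s, Phi (leading l) s & branch l (elem t) = elem s.
Proof.
move=> Ht; elim: l => [|b l [s Hs es]]; first by exists t => //; apply: over_xY_Phi.
case: b => /=; rewrite es.
  exists (lift_word false s); last by rewrite elem_lift_word mul1g.
  by apply: run_lift_word Hs => // i j Hi Hj; apply: leq_trans Hj _.
exists (map flip (lift_word false (map flip s))).
  apply: (@run_flip (fun i => 0 < i) xpredT _ _ _ S0) => //.
  apply: (@run_lift_word xpredT xpredT _ _ _ S0) => //.
  apply: (@run_flip xpredT xpredT _ _ _ S0) => //.
  exact: run_mono Hs.
by rewrite -sF_elem elem_lift_word mul1g -sF_elem sF_sL sFK.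
Qed.

Definition signed_perm (f : letter -> letter) :=
  injective f /\ forall a, f (invl a) = invl (f a).

(** A branch starting with [sR] is the flip of one starting with [sL]; for the empty branch, words
    over x, Y lie in every [Phi k]. *)
Lemma branch_Phi l : exists k f, [/\ 0 < k, signed_perm f & forall t, over_xY t ->
  exists2 s, Phi k s & branch l (elem t) = elem (map f s)].
Proof.
case: l => [|[] l].
- exists 1, id; split=> // [|t Ht]; first by split.
  exists t; rewrite ?map_id //; exact: over_xY_Phi.
- exists (leading l).+1, id; split=> // [|t Ht]; first by split.
  by have [s Hs es] := branch_over_xY (true :: l) Ht; exists s; rewrite ?map_id.
- exists (leading (map negb l)).+1, flip; split=> // [|t Ht].
    by split=> [|a]; [apply: can_inj flipK | elim/letter_ind: a].
  have [s Hs es] := branch_over_xY (true :: map negb l) (over_xY_flip Ht).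
  exists s => //; rewrite -sF_elem -es -sF_elem /= sF_sL -sF_branch sFK //.
Qed.

Definition positive_letters (s : seq letter) := all (fun a => a.2) s.

Lemma branch_positive l t : positive_letters t ->
  exists2 s, positive_letters s & branch l (elem t) = elem s.
Proof.
move=> Ht; elim: l => [|b l [s Hs es]]; first by exists t.
rewrite /= {}es.
have H u v : positive_letters u -> positive_letters v ->
    exists2 s', positive_letters s' & subst (elem u) (elem v) (elem s) = elem s'.
  move=> Hu Hv; exists (flatten [seq if a.1 == ord0 then u else v | a <- s]).
    elim: s Hs => //= a s IHs /andP[_ /IHs].
    by rewrite /positive_letters all_cat => ->; case: ifP => _; rewrite andbT.
  elim: s Hs => [|a s IHs] /=; first by rewrite subst_elem eval0 elem0.
  case/andP=> Ha Hs; rewrite elem_cons substM IHs // elem_cat subst_gl /basis_letter Ha.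
  by case: ifP.
case: b.
  have [|//|s' ? e] := H [:: lx] [:: lx; ly] => //.
  by exists s'; rewrite // -e /sL !(elem_cons, elem0) !mulg1.
have [|//|s' ? e] := H [:: lx; ly] [:: ly] => //.
by exists s'; rewrite // -e /sR !(elem_cons, elem0) !mulg1.
Qed.

(** * Tree pairs as images of the standard basis under branches *)

Definition chart (a b : letter) l h g : F2 := ((subst (gl a) (gl b) (branch l g)) ^ h)%g.

Lemma hom_chart a b l h : hom (chart a b l h).
Proof. by move=> g g'; rewrite /chart hom_branch substM conjMg. Qed.

Lemma chart_sL a b l h : chart a b (rcons l true) h gx = chart a b l h gx /\
  chart a b (rcons l true) h gy = (chart a b l h gx * chart a b l h gy)%g.
Proof. by rewrite -hom_chart /chart !branch_rcons /sL !subst_gl. Qed.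

Lemma chart_sR a b l h :
  chart a b (rcons l false) h gx = (chart a b l h gx * chart a b l h gy)%g /\
  chart a b (rcons l false) h gy = chart a b l h gy.
Proof. by rewrite -hom_chart /chart !branch_rcons /sR !subst_gl. Qed.

Lemma chart_conj a b l h h' g :
  chart a b l (h * h')%g g = (chart a b l h g ^ h')%g.
Proof. by rewrite /chart conjgM. Qed.

(** A multiplication extends the branch at its inner end, by [sL] or [sR] according to the order of
    the pair; where the factors come in the wrong order, a conjugation exchanges them. *)
Lemma tree_chart u v : tree_pair u v -> exists a b l h, a.1 != b.1 /\
  let p := chart a b l h gx in let q := chart a b l h gy in
  [\/ u = p /\ v = q, u = q /\ v = p,
      u = p^-1%g /\ v = q^-1%g | u = q^-1%g /\ v = p^-1%g].
Proof.
elim=> {u v} [a b ab|u v h' _|u v _|u v _|u v _].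
- exists a, b, [::], 1%g; split=> //=; apply: Or41.
  by rewrite /chart /= !conjg1 !subst_gl.
- move=> [a [b [l [h [ab H]]]]]; exists a, b, l, (h * h')%g; split=> //=.
  rewrite !chart_conj.
  case: H => [] [-> ->]; rewrite ?conjVg;
    by [apply: Or41 | apply: Or42 | apply: Or43 | apply: Or44].
- move=> [a [b [l [h [ab H]]]]]; exists a, b, l, h; split=> //=.
  by case: H => [] [-> ->]; [apply: Or42 | apply: Or41 | apply: Or44 | apply: Or43].
- move=> [a [b [l [h [ab H]]]]]; exists a, b, l, h; split=> //=.
  case: H => [] [-> ->]; rewrite ?invgK;
    by [apply: Or43 | apply: Or44 | apply: Or41 | apply: Or42].
- move=> [a [b [l [h [ab]]]]] /=.
  set p := chart a b l h gx; set q := chart a b l h gy.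
  have [eL1 eL2] := chart_sL a b l h; have [eR1 eR2] := chart_sR a b l h.
  rewrite -/p -/q in eL1 eL2 eR1 eR2; clearbody p q.
  case=> [] [-> ->].
  + exists a, b, (rcons l true), h; split=> //=; apply: Or41.
    by rewrite eL1 eL2.
  + exists a, b, (rcons l false), (h * q^-1)%g; split=> //=; apply: Or42.
    by rewrite !chart_conj eR1 eR2 !conjgE !invgK !mulgA !mulgK.
  + exists a, b, (rcons l true), (h * p)%g; split=> //=; apply: Or43.
    by rewrite !chart_conj eL1 eL2 !conjgE -(mulgA p) !mulKg invgM.
  + exists a, b, (rcons l false), h; split=> //=; apply: Or44.
    by rewrite eR1 eR2 -invgM.
Qed.

Definition tau (a b c : letter) : letter :=
  let d := if c.1 == ord0 then a else b in if c.2 then d else invl d.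

Lemma tau_signed a b : a.1 != b.1 -> signed_perm (tau a b).
Proof.
move=> ab; split; last first.
  by move=> c; rewrite /tau /=; case: c.2 => //=; rewrite invlK.
have N (c d : letter) : c.1 != d.1 -> (c == d) = false.
  by move=> cd; apply: contraNF cd => /eqP->.
have ba : b.1 != a.1 by rewrite eq_sym.
have Ha := negbTE (invl_neq a); have Hb := negbTE (invl_neq b).
have F := (Ha, Hb, etrans (eq_sym _ _) Ha, etrans (eq_sym _ _) Hb, N _ _ ab, N _ _ ba,
  N a (invl b) ab, N b (invl a) ba, N (invl a) b ab, N (invl b) a ba,
  N (invl a) (invl b) ab, N (invl b) (invl a) ba).
by move=> c d; elim/letter_ind: c; elim/letter_ind: d => //= /eqP;
  rewrite /tau /= !F.
Qed.

Lemma subst_tau a b s : subst (gl a) (gl b) (elem s) = elem (map (tau a b) s).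
Proof.
elim: s => [|c s IHs] /=; first by rewrite !elem0 subst1.
rewrite !elem_cons substM IHs subst_gl; congr (_ * _)%g.
by rewrite /basis_letter /tau; case: c.2; case: eqP => // _; rewrite gl_inv.
Qed.

Lemma signed_comp f f' : signed_perm f -> signed_perm f' -> signed_perm (f \o f').
Proof. by move=> [i c] [i' c']; split=> [|a /=]; [apply: inj_comp | rewrite c' c]. Qed.

Lemma chart_over_xY a b l h : a.1 != b.1 -> exists k f, [/\ 0 < k, signed_perm f
  & forall t, over_xY t ->
      exists2 s, Phi k s & chart a b l h (elem t) = (elem (map f s) ^ h)%g].
Proof.
move=> ab; have [k [f [k0 Hf H]]] := branch_Phi l.
exists k, (tau a b \o f); split=> // [|t /H[s Hs es]].
  by apply: signed_comp => //; apply: tau_signed.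
by exists s => //; rewrite /chart es subst_tau -map_comp.
Qed.

Definition invert_y := tau lx lY.

Lemma invert_yK : involutive invert_y. Proof. by move=> c; elim/letter_ind: c. Qed.

Lemma positive_invert_y s : positive_letters s -> over_xY (map invert_y s).
Proof. by rewrite /over_xY all_map; apply: sub_all => c; elim/letter_ind: c. Qed.

(** Branches preserve positive words, and inverting y turns these into words over x, Y, which every
    [Phi k] contains. *)
Lemma chart_positive a b l h : a.1 != b.1 -> exists k f, [/\ 0 < k, signed_perm f
  & forall t, positive_letters t ->
      exists2 s, Phi k s & chart a b l h (elem t) = (elem (map f s) ^ h)%g].
Proof.
move=> ab; exists 1, (tau a b \o invert_y); split=> // [|t /(branch_positive l)[s Hs es]].
  by apply: signed_comp; apply: tau_signed.
exists (map invert_y s); first by apply/over_xY_Phi/positive_invert_y.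
rewrite /chart es subst_tau map_comp; congr ((elem _) ^ _)%g; congr map.
by rewrite -map_comp (eq_map invert_yK) map_id.
Qed.

Lemma eval_rev_inv u v t : eval u^-1%g v^-1%g t = (eval u v (rev t))^-1%g.
Proof.
elim: t => [|a t IHt]; first by rewrite !eval0 invg1.
rewrite eval_cons rev_cons -cats1 eval_cat invgM -IHt eval_cons eval0 mulg1.
by rewrite /basis_letter; case: eqP; case: a.2.
Qed.

Definition swap_letter (a : letter) : letter :=
  (if a.1 == ord0 then ord_max else ord0, a.2).

Lemma eval_swap u v t : eval u v t = eval v u (map swap_letter t).
Proof.
elim: t => [|a t IHt] /=; first by rewrite !eval0.
by rewrite !eval_cons IHt; congr (_ * _)%g; elim/letter_ind: a.
Qed.

Lemma eval_flip u v t : eval u^-1%g v^-1%g t = eval v u (map flip t).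
Proof.
elim: t => [|a t IHt] /=; first by rewrite !eval0.
by rewrite !eval_cons IHt; congr (_ * _)%g; elim/letter_ind: a;
  rewrite /basis_letter /= ?invgK.
Qed.

Lemma eval_invert_y u v t : eval u v t = eval u v^-1%g (map invert_y t).
Proof.
elim: t => [|a t IHt] /=; first by rewrite !eval0.
by rewrite !eval_cons IHt; congr (_ * _)%g; elim/letter_ind: a;
  rewrite /basis_letter /= ?invgK.
Qed.

Lemma over_xY_rev t : over_xY (rev t) = over_xY t. Proof. exact: all_rev. Qed.
Lemma positive_rev t : positive_letters (rev t) = positive_letters t.
Proof. exact: all_rev. Qed.
Lemma positive_swap t : positive_letters (map swap_letter t) = positive_letters t.
Proof. by rewrite /positive_letters all_map. Qed.

Definition signed (e : bool) (g : F2) := if e then g else g^-1%g.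

Lemma chart_eval a b l h t :
  eval (chart a b l h gx) (chart a b l h gy) t = chart a b l h (elem t).
Proof. by rewrite -hom_eval ?eval_gen //; apply: hom_chart. Qed.

Lemma tree_pos u v t : tree_pair u v -> positive_letters t -> exists a b l h e t',
  [/\ a.1 != b.1, positive_letters t' & eval u v t = signed e (chart a b l h (elem t'))].
Proof.
move=> /tree_chart[a [b [l [h [ab H]]]]] Ht; exists a, b, l, h; move: H => /=.
case=> [] [-> ->].
- by exists true, t; rewrite chart_eval.
- by exists true, (map swap_letter t); rewrite positive_swap eval_swap chart_eval.
- by exists false, (rev t); rewrite positive_rev eval_rev_inv chart_eval.
- exists false, (rev (map swap_letter t)); rewrite positive_rev positive_swap.
  by rewrite eval_swap eval_rev_inv chart_eval.
Qed.

(** Swapping or inverting the pair amounts to flipping or reversing the word, up to a global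
    inverse; both preserve words over x, Y. *)
Lemma tree_over_xY u v t : tree_pair u v -> over_xY t -> exists a b l h e t',
  [/\ a.1 != b.1, over_xY t' & eval u v t = signed e (chart a b l h (elem t'))].
Proof.
move=> /tree_chart[a [b [l [h [ab H]]]]] Ht; exists a, b, l, h; move: H => /=.
case=> [] [-> ->].
- by exists true, t; rewrite chart_eval.
- exists false, (map flip (rev t)); split=> //.
    by apply: over_xY_flip; rewrite over_xY_rev.
  by rewrite -chart_eval -eval_flip eval_rev_inv revK /= invgK.
- by exists false, (rev t); rewrite over_xY_rev eval_rev_inv chart_eval.
- by exists true, (map flip t); rewrite eval_flip chart_eval; split=> //; apply: over_xY_flip.
Qed.

Definition cat_closed (K : pred (seq letter)) := forall s t, K s -> K t -> K (s ++ t).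

Lemma chart_power (K : pred (seq letter)) a b l h e t k f :
  K [::] -> cat_closed K -> K t ->
  (forall t, K t -> exists2 s, Phi k s & chart a b l h (elem t) = (elem (map f s) ^ h)%g) ->
  forall N, exists2 s, Phi k s &
    ((signed e (chart a b l h (elem t))) ^+ N = (signed e (elem (map f s))) ^ h)%g.
Proof.
move=> K0 KM Kt H N.
have [s Hs es] : exists2 s, Phi k s & (chart a b l h (elem t) ^+ N = elem (map f s) ^ h)%g.
  suff [t' Kt' <-] : exists2 t', K t' &
      chart a b l h (elem t') = (chart a b l h (elem t) ^+ N)%g.
    exact: H.
  elim: N => [|N [t' Kt' et']].
    by exists [::] => //; rewrite elem0 expg0 (hom1 (hom_chart _ _ _ _)).
  by exists (t ++ t'); [apply: KM | rewrite elem_cat hom_chart et' expgS].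
by exists s => //; case: e => /=; rewrite ?expVgn es // conjVg.
Qed.

Lemma pp_basis w : potentially_positive w -> exists u v t,
  [/\ generates u v, positive_letters t & w = eval u v t].
Proof.
move=> [phi [[psi phiK psiK] [s es]]].
have homp : hom psi by move=> g g'; rewrite -{1}[g]psiK -{1}[g']psiK -gmulfM phiK.
exists (psi gx), (psi gy), [seq (i, true) | i <- s]; split.
- move=> P P1 PM PV Px Py g; rewrite -[g]phiK -[phi g]elem_word.
  elim: (word (phi g)) => [|a t IHt]; first by rewrite elem0 (hom1 homp).
  rewrite elem_cons homp; apply: PM => //.
  elim/letter_ind: a => //.
    rewrite (_ : gl lX = gx^-1)%g ?(homV _ homp); [exact: PV | exact: word_inj].
  rewrite (_ : gl lY = gy^-1)%g ?(homV _ homp); [exact: PV | exact: word_inj].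
- by rewrite /positive_letters all_map; apply/allP.
rewrite -hom_eval // eval_gen -[LHS]phiK es /elem big_map; congr psi.
Qed.

(** If the tree pair contains [v], the word stays positive; if it contains [v^-1], the word becomes
    one over x, Y. *)
Lemma pp_struct w : potentially_positive w -> exists k f h e,
  [/\ 0 < k, signed_perm f & forall N, exists2 s, Phi k s &
    (w ^+ N = (signed e (elem (map f s))) ^ h)%g].
Proof.
move=> /pp_basis[u [v [t [/generates_nielsen Huv Ht ->]]]].
case: Huv => Huv.
  have [a [b [l [h [e [t' [ab Ht' ->]]]]]]] := tree_pos Huv Ht.
  have [k [f [k0 Hf H]]] := chart_positive l h ab.
  exists k, f, h, e; split=> //; apply: (@chart_power positive_letters) => //.
  by move=> s1 s2; rewrite /positive_letters all_cat => -> ->.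
rewrite eval_invert_y.
have [a [b [l [h [e [t' [ab Ht' ->]]]]]]] := tree_over_xY Huv (positive_invert_y Ht).
have [k [f [k0 Hf H]]] := chart_over_xY l h ab.
exists k, f, h, e; split=> //; apply: (@chart_power over_xY) => //.
by move=> s1 s2; rewrite /over_xY all_cat => -> ->.
Qed.

(** * Words of potentially positive elements *)

Lemma cat_split (T : Type) (s1 t1 s2 t2 : seq T) :
  s1 ++ t1 = s2 ++ t2 -> size s1 <= size s2 ->
  exists2 m, s2 = s1 ++ m & t1 = m ++ t2.
Proof.
elim: s1 s2 => [|a s1 IHs] [|b s2] //= H; first by exists [::].
  by exists (b :: s2).
by rewrite ltnS => Hs; case: H => -> /IHs/(_ Hs)[m -> ->]; exists m.
Qed.

Lemma reduced_nseq (c : seq letter) N : reduced (c ++ c) ->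
  reduced (flatten (nseq N c)).
Proof.
move=> Hc; have [-> | c0] := eqVneq c [::]; first by elim: N.
elim: N => [|[|N] IHN] //=; first by rewrite cats0; exact: reduced_catl Hc.
exact: reduced_glue.
Qed.

Lemma elem_power (c : seq letter) N : (elem c ^+ N)%g = elem (flatten (nseq N c)).
Proof. by elim: N => [|N IHN]; rewrite ?elem0 // expgS IHN /= elem_cat. Qed.

(* In c^(2n+1) with n = |h|, conjugation by h does not reach the middle factor c. *)
Lemma infix_power (c : seq letter) (g h : F2) : reduced (c ++ c) ->
  (elem c ^+ (len h + (1 + len h)) = g ^ h)%g ->
  exists s t, word g = s ++ c ++ t.
Proof.
move=> Hc; have [-> _|c0] := eqVneq c [::]; first by exists [::], (word g).
rewrite conjgE elem_power => /(congr1 (@word 2)).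
rewrite word_elem ?reduced_nseq // nseqD flatten_cat.
rewrite -[flatten (nseq (1 + _) c)]/(c ++ flatten (nseq _ c)).
set P := flatten _.
have sP : len h <= size P.
  rewrite size_flatten /shape map_nseq sumn_nseq.
  by apply: leq_pmull; rewrite lt0n size_eq0.
have [a [b [c1 [eg eh egh]]]] := mul_cancel g h.
have [a2 [b2 [c2 [eh' egh' ->]]]] := mul_cancel (h^-1)%g (g * h)%g.
have sb : size b <= len h by rewrite /len eh size_cat leq_addl.
have sa : size a2 <= len h by rewrite -lenV /len eh' size_cat leq_addr.
move/esym/cat_split => /(_ (leq_trans sa sP))[m _ eb2].
have : a ++ b = (invs c2 ++ m ++ c) ++ P by rewrite -egh egh' eb2 !catA.
move/esym/cat_split => [|m' ea _].
  have := congr1 size egh'; rewrite egh eb2 !size_cat; lia.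
by exists (invs c2 ++ m), (m' ++ c1); rewrite eg ea !catA.
Qed.

Lemma Phi_infix k s1 s s2 : Phi k (s1 ++ s ++ s2) -> Phi k s.
Proof.
by move=> /(@run_catr _ _ (fun i j ij => leq_trans ij)) /run_catl.
Qed.

Lemma Phi_reduced k s : Phi k s -> reduced s.
Proof. exact: run_reduced. Qed.

Lemma reduced_map f s : signed_perm f -> reduced (map f s) = reduced s.
Proof.
move=> [fi fV]; rewrite /reduced sorted_map; apply: eq_sorted => a b /=.
by rewrite -fV (inj_eq fi).
Qed.

(** By [infix_power] the core [c] is a factor of a word from [pp_struct], and [Phi k] is closed
    under factors. *)
Lemma pp_word (w : F2) : potentially_positive w -> exists (a c : seq letter),
  word w = a ++ c ++ invs a /\ exists k f s, [/\ 0 < k, signed_perm f, Phi k s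
    & c = map f s \/ c = invs (map f s)].
Proof.
move=> /pp_struct[k [f [h [e [k0 Hf H]]]]].
have [a [c [ew Hc _]]] := cyclic_reduction (wordP w).
exists a, c; split=> //; exists k, f.
set h' := (h * elem a)%g; have [s Hs es] := H (len h' + (1 + len h')).
have [|s1 [s2 es12]] := @infix_power c (signed e (elem (map f s))) h' Hc.
  rewrite /h' conjgM -es conjXg; congr (_ ^+ _)%g.
  by rewrite -[w]elem_word ew !elem_cat elem_invs conjgE !mulgA mulVg mul1g mulgVK.
have Hred : reduced (map f s) by rewrite reduced_map // (Phi_reduced Hs).
have infixP t1 t t2 : map f s = t1 ++ t ++ t2 -> exists2 s', Phi k s' & t = map f s'.
  move=> E; exists (take (size t) (drop (size t1) s)).
    rewrite -(cat_take_drop (size t1) s) in Hs.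
    rewrite -(cat_take_drop (size t) (drop _ s)) in Hs.
    exact: Phi_infix Hs.
  by rewrite map_take map_drop E drop_size_cat // take_size_cat.
case: e es12 {H es} => /=; rewrite ?wordV word_elem // => E.
  by have [s' Hs' ->] := infixP _ _ _ E; exists s'; split=> //; left.
have [|s' Hs' E'] := infixP (invs s2) (invs c) (invs s1).
  by rewrite -[LHS]invsK E !invs_cat !catA.
by exists s'; split=> //; right; rewrite -E' invsK.
Qed.

(** * Cutting a word at its least gap *)

Definition Linf := run xpred0 xpredT S0.

Fixpoint after (cy cx : pred nat) (q : state) (s : seq letter) : option state :=
  if s is a :: s' then obind (fun q' => after cy cx q' s') (step cy cx q a)
  else Some q.

Lemma after_rcons cy cx q s a :
  after cy cx q (rcons s a) = obind (fun q' => step cy cx q' a) (after cy cx q s).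
Proof. by elim: s q => [|b s IHs] q //=; case: step => //= q'; rewrite ?IHs. Qed.

Lemma after_SY cy cx g p : after cy cx S0 p = Some (SY g) ->
  exists p', p = p' ++ ly :: nseq g lx.
Proof.
elim/last_ind: p g => // p a IHp g; rewrite after_rcons.
case: (after cy cx S0 p) IHp => [[|||i|i]|] // IHp;
  elim/letter_ind: a => //=; try case: ifP => // _; case=> <- //;
  try by exists p; rewrite cats1.
have [//|p' ->] := IHp i; exists p'; rewrite rcons_cat /=.
by rewrite -cats1 -(nseqD i 1) addn1.
Qed.

(** The two automata first differ where y is read in the state [SY g]. *)
Lemma run_gap (cx : pred nat) g q s : run (fun i => g <= i) cx q s ->
  ~~ run (fun i => g.+1 <= i) cx q s -> exists p t, s = p ++ ly :: t /\
    after (fun i => g <= i) cx q p = Some (SY g).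
Proof.
elim: s q => //= a s IHs q.
case Eq: (step (leq g) cx q a) => [q1|] // Hr.
have [E|E] : (step (leq g.+1) cx q a = step (leq g) cx q a) \/ (q = SY g /\ a = ly).
  elim/letter_ind: a Eq; case: q => [|||i|i] //=; try by left.
  case: (ltngtP g i) => //; try by left.
  by move=> -> _; right.
  rewrite E Eq => /(IHs _ Hr)[p [t [-> Hp]]].
  by exists (a :: p), t; rewrite /= Eq.
by case: E => -> -> _; exists [::], s.
Qed.

Lemma run_nogap (cx : pred nat) N q s :
  (if q is SY i then i else 0) + size s <= N ->
  run (fun i => N <= i) cx q s -> run xpred0 cx q s.
Proof.
elim: s q => //= a s IHs q.
elim/letter_ind: a; case: q => [|||i|i] //= H; try (by apply: IHs => //=; lia).
- by case: ifP => // _; apply: IHs => /=; lia.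
- by case: leqP => //; lia.
- by case: ifP => // _; apply: IHs => /=; lia.
Qed.

(** Let [g] be the least gap. As [k <= g], the bound on runs of X relaxes to [g], and the word is
    cut around x^g, whose letters are determined. No gap reaches k plus the length of the word, so
    the search for [g] ends. *)
Lemma Phi_split k s : 0 < k -> Phi k s -> Linf s \/
  exists g p t, [/\ 0 < g, s = p ++ nseq g lx ++ t, Phi g p & Phi g t].
Proof.
move=> k0 Hs; set cx := fun i => i <= k.
have [H|[g [kg H1 H2]]] : run (fun i => k + size s <= i) cx S0 s \/
    exists g, [/\ k <= g, run (fun i => g <= i) cx S0 s
      & ~~ run (fun i => g.+1 <= i) cx S0 s].
- elim: (size s) => [|d [H|]]; [by left; rewrite addn0| |by right].
  rewrite addnS; case: (boolP (run (fun i => (k + d).+1 <= i) cx S0 s)) => H'; first by left.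
  by right; exists (k + d); rewrite leq_addr.
- by left; apply: run_mono (run_nogap _ H) => //; rewrite add0n leq_addl.
right; have [p [t [es Hp]]] := run_gap H1 H2.
have [p' ep] := after_SY Hp; exists g, (rcons p' ly), (ly :: t).
have e1 : s = rcons p' ly ++ nseq g lx ++ ly :: t by rewrite es ep -cats1 -!catA.
have Hg : Phi g s by apply: run_mono H1 => // i /leq_trans; apply.
rewrite {1}e1 (leq_trans k0 kg); split=> //; rewrite e1 in Hg.
  exact: run_catl Hg.
by rewrite catA in Hg; apply: run_catr Hg => i j ij /(leq_trans ij).
Qed.

(** * Counting *)

Definition cnt (L : pred (seq letter)) n := #|[set t : n.-tuple letter | L t]|.

Definition words (L : pred (seq letter)) n : seq (seq letter) :=
  [seq val t | t in [set t : n.-tuple letter | L t]].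

Lemma size_words L n : size (words L n) = cnt L n.
Proof. by rewrite size_map -cardE. Qed.

Lemma mem_words (L : pred (seq letter)) s : L s -> s \in words L (size s).
Proof.
move=> Ls; apply/imageP; exists (in_tuple s) => //.
by rewrite inE.
Qed.

Lemma cnt_le (L : pred (seq letter)) n l :
  (forall s, size s = n -> L s -> s \in l) -> cnt L n <= size l.
Proof.
move=> H; rewrite -size_words; apply: uniq_leq_size.
  by rewrite map_inj_uniq ?enum_uniq //; apply: val_inj.
move=> s /imageP[t]; rewrite inE => Lt ->; apply: H => //.
exact: size_tuple.
Qed.

Lemma size_sum_map (I : Type) (T : Type) (r : seq I) (F : I -> seq T) :
  size (flatten [seq F i | i <- r]) = \sum_(i <- r) size (F i).
Proof. by rewrite size_flatten /shape -map_comp sumnE big_map. Qed.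

Definition PhiU (s : seq letter) : bool := `[< exists2 k, 0 < k & Phi k s >].

Lemma cnt_PhiU m : cnt PhiU m <= cnt Linf m +
  \sum_(1 <= g < m.+1) \sum_(0 <= j < (m - g).+1)
    cnt (Phi g) j * cnt (Phi g) (m - g - j).
Proof.
pose E g j := [seq p ++ nseq g lx ++ t | p <- words (Phi g) j,
  t <- words (Phi g) (m - g - j)].
pose l := words Linf m ++ flatten [seq flatten [seq E g j | j <- index_iota 0 (m - g).+1]
  | g <- index_iota 1 m.+1].
have -> : (cnt Linf m + \sum_(1 <= g < m.+1) \sum_(0 <= j < (m - g).+1)
    cnt (Phi g) j * cnt (Phi g) (m - g - j))%N = size l.
  rewrite size_cat size_words size_sum_map; congr (_ + _)%N; apply: eq_bigr => g _.
  rewrite size_sum_map; apply: eq_bigr => j _.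
  by rewrite size_allpairs !size_words.
apply: cnt_le => s ss /asboolP[k k0 /(Phi_split k0)]; rewrite mem_cat.
case=> [Hs|[g [p [t [g0 es Hp Ht]]]]]; first by rewrite -ss mem_words.
apply/orP; right; apply/flatten_mapP.
have em : m = (size p + g + size t)%N by rewrite -ss es !size_cat size_nseq addnA.
exists g; first by rewrite mem_index_iota; lia.
apply/flatten_mapP; exists (size p); first by rewrite mem_index_iota; lia.
apply/allpairsP; exists (p, t); rewrite /= mem_words //; split=> //.
by rewrite (_ : m - g - size p = size t) ?mem_words //; lia.
Qed.

Definition PhiS (s : seq letter) : bool := `[< exists f t, [/\ signed_perm f, PhiU t
  & s = map f t \/ s = invs (map f t)] >].

(** Signed permutations are among the 4^4 = 256 maps of the letters; inversion doubles the count. *)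
Lemma cnt_PhiS m : cnt PhiS m <= 512 * cnt PhiU m.
Proof.
pose l := [seq map (f : {ffun letter -> letter}) t |
    f <- enum {ffun letter -> letter}, t <- words PhiU m].
have sl : size l = 256 * cnt PhiU m.
  by rewrite size_allpairs size_words -cardE card_ffun !card_prod card_ord card_bool.
have -> : 512 * cnt PhiU m = size (l ++ map (@invs 2) l).
  by rewrite size_cat size_map sl -mulnDl.
apply: cnt_le => s ss /asboolP[f [t [_ Ht es]]]; rewrite mem_cat.
have st : size t = m by case: es ss => ->; rewrite ?size_invs size_map.
have Hl : map f t \in l.
  apply/allpairsP; exists (finfun f, t); rewrite /= mem_enum; split=> //.
    by rewrite -st mem_words.
  by apply: eq_map => a; rewrite ffunE.
by case: es => ->; rewrite ?Hl // map_f ?orbT.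
Qed.

Lemma num_pp_le n : num_potentially_positive 2 n <=
  \sum_(0 <= j < n./2.+1) 4 ^ j * cnt PhiS (n - j.*2).
Proof.
pose l := flatten [seq
  [seq a ++ c ++ invs a | a <- words xpredT j, c <- words PhiS (n - j.*2)]
  | j <- index_iota 0 n./2.+1].
have -> : \sum_(0 <= j < n./2.+1) 4 ^ j * cnt PhiS (n - j.*2) = size l.
  rewrite size_sum_map; apply: eq_bigr => j _; rewrite size_allpairs !size_words.
  by rewrite /cnt cardsT card_tuple card_prod card_ord card_bool.
pose L s := `[< exists w : F2, potentially_positive w /\ word w = s >].
apply: (@cnt_le L) => s ss /asboolP[w [/pp_word[a [c [ew [k [f [t [k0 Hf Ht ec]]]]]]] es]].
have Hc : PhiS c by apply/asboolP; exists f, t; split=> //; apply/asboolP; exists k.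
have en : n = (size a + size c + size a)%N.
  by rewrite -ss -es ew !size_cat size_invs addnA.
apply/flatten_mapP; exists (size a); first by rewrite mem_index_iota; lia.
apply/allpairsP; exists (a, c); rewrite /= -es ew; split=> //; first exact: mem_words.
by rewrite (_ : n - (size a).*2 = size c) ?mem_words //; lia.
Qed.

(** * Weights on the states and the transition matrix *)

Section Weights.
Local Open Scope ring_scope.
Variable R : realType.
Variables (cy cx : pred nat).

Lemma cnt_run0 q : cnt (run cy cx q) 0 = 1%N.
Proof.
rewrite /cnt; apply/eqP/cards1P; exists [tuple]; apply/setP => t.
by rewrite !inE (tuple0 t) eqxx.
Qed.

Lemma cnt_runS q n : cnt (run cy cx q) n.+1 =
  (\sum_a if step cy cx q a is Some q' then cnt (run cy cx q') n else 0)%N.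
Proof.
pose h (u : letter * n.-tuple letter) : n.+1.-tuple letter := [tuple of u.1 :: u.2].
have hi : injective h by move=> [a t] [b u] /(congr1 val)[-> /val_inj->].
pose A := [set u : letter * n.-tuple letter | run cy cx q (u.1 :: u.2)].
have -> : cnt (run cy cx q) n.+1 = #|h @: A|.
  apply: eq_card => t; rewrite inE.
  apply/idP/imsetP => [Ht|[u]]; last by rewrite inE => ? ->.
  case/tupleP: t Ht => a t Ht; exists (a, t); rewrite ?inE //.
rewrite card_imset // -sum1_card.
rewrite (eq_bigl (fun u : letter * n.-tuple letter =>
  predT u.1 && run cy cx q (u.1 :: u.2))); last by move=> u; rewrite inE.
rewrite -(pair_big_dep predT
  (fun a (t : n.-tuple letter) => run cy cx q (a :: t)) (fun _ _ => 1%N)) /=.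
apply: eq_bigr => a _; case: step => [q'|]; last by rewrite big_pred0.
by rewrite sum1_card; apply: eq_card => t; rewrite !inE.
Qed.


Lemma sum_letter (w : letter -> R) : \sum_a w a = w lx + w lX + w ly + w lY.
Proof.
transitivity (\sum_i \sum_b w (i, b)).
  by rewrite pair_bigA; apply: eq_bigr => -[].
rewrite big_ord_recl big_ord1 !big_bool !addrA.
by rewrite (_ : lift ord0 ord0 = ord_max) //; apply: val_inj.
Qed.

Variables (f : state -> R) (mu : R).

Definition out (q : state) : R :=
  \sum_a if step cy cx q a is Some q' then f q' else 0.

Lemma outE q : let w a := if step cy cx q a is Some q' then f q' else 0 in
  out q = w lx + w lX + w ly + w lY.
Proof. exact: sum_letter. Qed.

(** Collatz-Wielandt argument: [out] is the transition matrix applied to [f], and it advances the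
    length by one. *)
Lemma cnt_run_ub (m : R) q n : 0 <= mu -> (forall q, out q <= mu * f q) ->
  (forall q, m <= f q) -> m * (cnt (run cy cx q) n)%:R <= f q * mu ^+ n.
Proof.
move=> mu0 Hout Hm; elim: n q => [|n IHn] q; first by rewrite cnt_run0 expr0 !mulr1.
rewrite cnt_runS natr_sum mulr_sumr exprS mulrA (mulrC (f q)).
apply: le_trans (ler_wpM2r (exprn_ge0 n mu0) (Hout q)).
rewrite /out mulr_suml; apply: ler_sum => a _.
by case: step => [q'|]; rewrite ?mulr0 ?mul0r.
Qed.

Lemma cnt_run_lb (m : R) q n : 0 <= mu -> (forall q, mu * f q <= out q) ->
  (forall q, f q <= m) -> f q * mu ^+ n <= m * (cnt (run cy cx q) n)%:R.
Proof.
move=> mu0 Hout Hm; elim: n q => [|n IHn] q; first by rewrite cnt_run0 expr0 !mulr1.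
rewrite cnt_runS natr_sum mulr_sumr exprS mulrA (mulrC (f q)).
apply: le_trans (ler_wpM2r (exprn_ge0 n mu0) (Hout q)) _.
rewrite /out mulr_suml; apply: ler_sum => a _.
by case: step => [q'|]; rewrite ?mulr0 ?mul0r.
Qed.
End Weights.

(** * Growth rates *)

Local Open Scope ring_scope.

Section Numeric.
Variable R : realFieldType.
Implicit Types x y c d lam mu s t rho : R.

Lemma le_invr c x : 0 < x -> c * x <= 1 -> c <= x^-1.
Proof. by move=> x0 H; rewrite -[x^-1]mul1r ler_pdivlMr. Qed.

Lemma invr_le c x : 0 < x -> 1 <= c * x -> x^-1 <= c.
Proof. by move=> x0 H; rewrite -[x^-1]mul1r ler_pdivrMr. Qed.

(** Interval multiplication, which hands bounds on products to linear arithmetic. *)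
Lemma le_mul_itv a b x c d y : 0 <= a -> 0 <= c -> a <= x <= b -> c <= y <= d ->
  a * c <= x * y <= b * d.
Proof.
move=> a0 c0 /andP[ax xb] /andP[cy yd]; apply/andP; split; apply: ler_pM => //.
  exact: le_trans ax.
exact: le_trans cy.
Qed.

Lemma inv_mu_itv mu : 249 / 100 <= mu <= 251 / 100 -> 39 / 100 <= mu^-1 <= 41 / 100.
Proof.
move=> /andP[h1 h2]; rewrite le_invr ?invr_le //; lra.
Qed.

Lemma inv_mu1_itv mu : 249 / 100 <= mu <= 251 / 100 ->
  33 / 50 <= (mu - 1)^-1 <= 17 / 25.
Proof.
move=> /andP[h1 h2]; rewrite le_invr ?invr_le //; lra.
Qed.

Lemma quartic_diff lam mu : 249 / 100 <= mu <= 251 / 100 ->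
  249 / 100 <= lam <= 251 / 100 -> mu <= lam ->
  lam ^+ 4 - 3 * lam ^+ 3 + lam ^+ 2 + lam - 1 -
  (mu ^+ 4 - 3 * mu ^+ 3 + mu ^+ 2 + mu - 1) <= (lam - mu) * 14.
Proof.
move=> Hm Hl le_ml.
have p0 : 0 <= 249 / 100 :> R by lra.
have q0 : 0 <= 249 / 100 * (249 / 100) :> R by lra.
have ll := le_mul_itv p0 p0 Hl Hl; have lm := le_mul_itv p0 p0 Hl Hm.
have mm := le_mul_itv p0 p0 Hm Hm.
have lll := le_mul_itv q0 p0 ll Hl; have llm := le_mul_itv q0 p0 ll Hm.
have lmm := le_mul_itv q0 p0 lm Hm; have mmm := le_mul_itv q0 p0 mm Hm.
have -> : lam ^+ 4 - 3 * lam ^+ 3 + lam ^+ 2 + lam - 1 -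
  (mu ^+ 4 - 3 * mu ^+ 3 + mu ^+ 2 + mu - 1) = (lam - mu) *
  (lam * lam * lam + lam * lam * mu + lam * mu * mu + mu * mu * mu
   - 3 * (lam * lam + lam * mu + mu * mu) + (lam + mu) + 1) by ring.
apply: ler_wpM2l; first by rewrite subr_ge0.
move: ll lm mm lll llm lmm mmm Hl Hm {q0 p0 le_ml}.
move: (lam * lam * lam) (lam * lam * mu) (lam * mu * mu) (mu * mu * mu).
move: (lam * lam) (lam * mu) (mu * mu) => x1 x2 x3 x4 x5 x6 x7.
by move=> /andP[? _] /andP[? _] /andP[? _] /andP[_ ?] /andP[_ ?] /andP[_ ?] /andP[_ ?]
  /andP[_ ?] /andP[_ ?]; lra.
Qed.

Section Step.
Variables (mu t : R).
Let s := (mu - 1)^-1.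
Let rho := mu^-1.
(** The weight of [SP] in [wPhi], found by solving the linear equation of [p_fix]; [t] stands for
    [rho ^+ k]. *)
Let p := s + rho * s ^+ 2 / (1 - s * t).
Hypothesis Hmu : 249 / 100 <= mu <= 251 / 100.
Hypothesis Ht : 0 <= t <= rho.

Lemma den_itv : 18 / 25 <= 1 - s * t <= 1.
Proof.
have Hs := inv_mu1_itv Hmu; have Hr := inv_mu_itv Hmu; rewrite -/s in Hs.
have t1 : t <= 41 / 100 by case/andP: Ht => _ /le_trans; apply; case/andP: Hr.
have Ht' : 0 <= t <= 41 / 100 by case/andP: Ht => ->.
have := @le_mul_itv (33 / 50) _ _ _ _ _ ltac:(lra) (lexx 0) Hs Ht'.
by rewrite mulr0; move: (s * t) => st /andP[h1 h2]; apply/andP; split; lra.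
Qed.

Lemma p_itv : s <= p <= 1.
Proof.
have Hs := inv_mu1_itv Hmu; have Hr := inv_mu_itv Hmu; have /andP[d1 d2] := den_itv.
rewrite -/s -/rho in Hs Hr.
have Hd : 1 <= (1 - s * t)^-1 <= 25 / 18.
  by rewrite le_invr ?invr_le //; move: d1 d2; move: (s * t) => st ? ?; lra.
have c0 : 0 <= 33 / 50 :> R by lra.
have r0 : 0 <= 39 / 100 :> R by lra.
have ss := le_mul_itv c0 c0 Hs Hs; rewrite -expr2 in ss.
have rss := le_mul_itv r0 (mulr_ge0 c0 c0) Hr ss.
have := le_mul_itv (mulr_ge0 r0 (mulr_ge0 c0 c0)) ler01 rss Hd.
rewrite /p; move: (rho * s ^+ 2 / _) => x /andP[x1 x2]; case/andP: Hs => s1 s2.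
by move: s1 s2 x1 x2; move: s => s' *; apply/andP; split; lra.
Qed.

Lemma p_fix : mu * p = p + (1 + (rho * s + (p - s) * t)).
Proof.
have /andP[d1 _] := den_itv; case/andP: (Hmu) => h1 h2.
have m0 : mu != 0 by apply: lt0r_neq0; move: h1; lra.
have m1 : mu - 1 != 0 by apply: lt0r_neq0; move: h1; lra.
have D0 : 1 - s * t != 0.
  by apply: lt0r_neq0; apply: lt_le_trans d1; lra.
have D1 : mu - 1 - t != 0.
  by apply: contraNneq D0 => /eqP; rewrite subr_eq0 => /eqP <-; rewrite mulVf // subrr.
by rewrite /p /s /rho; field; rewrite m0 m1 D1.
Qed.

(** The slack is the quartic plus (mu - 1) t (1 - e), times rho s^2. As (mu - 1) (1 - e) >= 1.49 *
    0.35 > 9/25, the quartic may be slightly negative, so [mu] may lie below [lam]. *)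
Lemma N_ineq : - (9 / 25) * t <= mu ^+ 4 - 3 * mu ^+ 3 + mu ^+ 2 + mu - 1 ->
  1 + p + s * (1 - rho * t) <= mu.
Proof.
move=> Hq; have /andP[d1 d2] := den_itv; case/andP: (Hmu) => h1 h2.
have Hs := inv_mu1_itv Hmu; rewrite -/s in Hs.
have m0 : mu != 0 by apply: lt0r_neq0; move: h1; lra.
have m1 : mu - 1 != 0 by apply: lt0r_neq0; move: h1; lra.
have D0 : 1 - s * t != 0.
  by apply: lt0r_neq0; apply: lt_le_trans d1; lra.
have D1 : mu - 1 - t != 0.
  by apply: contraNneq D0 => /eqP; rewrite subr_eq0 => /eqP <-; rewrite mulVf // subrr.
pose e := s ^+ 2 / (1 - s * t).
have Hd : 1 <= (1 - s * t)^-1 <= 25 / 18.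
  by rewrite le_invr ?invr_le //; move: d1 d2; move: (s * t) => st ? ?; lra.
have c0 : 0 <= 33 / 50 :> R by lra.
have ss := le_mul_itv c0 c0 Hs Hs; rewrite -expr2 in ss.
have e_le : e <= 13 / 20.
  have /andP[_] := le_mul_itv (mulr_ge0 c0 c0) ler01 ss Hd.
  by rewrite -/e => /le_trans; apply; lra.
rewrite -subr_ge0.
have -> : mu - (1 + p + s * (1 - rho * t)) =
  (mu ^+ 4 - 3 * mu ^+ 3 + mu ^+ 2 + mu - 1 + (mu - 1) * t * (1 - e)) * rho * s ^+ 2.
  by rewrite /e /p /s /rho; field; rewrite m0 m1 D1.
apply: mulr_ge0; last exact: sqr_ge0.
apply: mulr_ge0; last by rewrite invr_ge0; move: h1; lra.
case/andP: Ht => t0 _.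
have H1 : 149 / 100 * t * (7 / 20) <= (mu - 1) * t * (1 - e).
  apply: ler_pM; [| by lra | | by move: e_le; lra].
    by apply: mulr_ge0 => //; lra.
  by apply: ler_wpM2r => //; move: h1; lra.
move: Hq H1 t0; move: (_ * (1 - e)) (mu ^+ 4 - _ + _ + _ - 1) => x y.
by lra.
Qed.
End Step.
End Numeric.

Section Bounds.
Variable R : realType.
Variable lam : R.
Hypothesis lam_root : lam ^+ 4 - 3 * lam ^+ 3 + lam ^+ 2 + lam - 1 = 0.
Hypothesis lam_itv : 5 / 2 <= lam <= 251 / 100.

Let lam_itv' : 249 / 100 <= lam <= 251 / 100.
Proof. by move: lam_itv => /andP[h ->]; rewrite andbT; lra. Qed.

Let lam_gt0 : 0 < lam.
Proof. by move: lam_itv => /andP[h _]; lra. Qed.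

Section LinfWeight.
Let s := (lam - 1)^-1.
Let z := lam^-1.

(* The right eigenvector of the automaton for the eigenvalue lam. *)
Definition wLinf (q : state) : R :=
  match q with
  | S0 => (s * (1 + z * s) + s + z * s + 1) * z
  | SP => s * (1 + z * s)
  | SN => 1
  | SX _ => s
  | SY 0 => z * s
  | SY _ => s
  end.

Lemma wLinf_out q : out xpred0 xpredT wLinf q = lam * wLinf q.
Proof.
have l0 : lam != 0 by apply: lt0r_neq0.
have l1 : lam - 1 != 0.
  by apply: lt0r_neq0; move: lam_itv => /andP[h _]; move: h; lra.
rewrite outE; case: q => [|||i|[|i]] /=; rewrite /s /z.
- by field; rewrite ?l0 ?l1.
- by field; rewrite ?l0 ?l1.
(* The equation at [SN] is the quartic equation up to a nonzero factor. *)
- apply/eqP; rewrite -subr_eq0; apply/eqP.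
  transitivity (- (lam ^+ 4 - 3 * lam ^+ 3 + lam ^+ 2 + lam - 1) * lam^-1 *
    (lam - 1)^-1 ^+ 2).
    by field; rewrite ?l0 ?l1.
  by rewrite lam_root oppr0 !mul0r.
- by field; rewrite ?l0 ?l1.
- by field; rewrite ?l0 ?l1.
- by field; rewrite ?l0 ?l1.
Qed.

Lemma wLinf_itv q : 1 / 4 <= wLinf q <= 2.
Proof.
have Hs := inv_mu1_itv lam_itv'; have Hz := inv_mu_itv lam_itv'.
rewrite -/s -/z in Hs Hz.
have c0 : 0 <= 33 / 50 :> R by lra.
have r0 : 0 <= 39 / 100 :> R by lra.
have zs := le_mul_itv r0 c0 Hz Hs.
have P : 33 / 50 <= s * (1 + z * s) <= 1.
  have Ho : 1 <= 1 + z * s <= 13 / 10.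
    by case/andP: zs; move: (z * s) => x; move=> *; apply/andP; split; lra.
  by case/andP: (le_mul_itv c0 ler01 Hs Ho); move: (s * _); move=> *; apply/andP; split; lra.
have S : 1 <= s * (1 + z * s) + s + z * s + 1 <= 4.
  by case/andP: P zs Hs => ? ? /andP[? ?] /andP[? ?]; apply/andP; split; lra.
have W := le_mul_itv ler01 r0 S Hz.
have weak (a b x : R) : 1 / 4 <= a -> b <= 2 -> a <= x <= b -> 1 / 4 <= x <= 2.
  by move=> ha hb /andP[h1 h2]; rewrite (le_trans ha h1) (le_trans h2 hb).
case: q => [|||i|[|i]] /=; first [exact: weak W | apply: weak W | apply: weak P
  | apply: weak zs | apply: weak Hs | by apply/andP; split; lra]; lra.
Qed.

(** The factor 8 is the ratio of the bounds in [wLinf_itv]. *)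
Lemma cnt_Linf_ub n : (cnt Linf n)%:R <= 8 * lam ^+ n.
Proof.
have H : (1 / 4) * (cnt Linf n)%:R <= wLinf S0 * lam ^+ n.
  apply: cnt_run_ub; first exact: ltW.
    by move=> q; rewrite wLinf_out.
  by move=> q; have /andP[] := wLinf_itv q.
have /andP[_ H2] := wLinf_itv S0.
have := le_trans H (ler_wpM2r (exprn_ge0 n (ltW lam_gt0)) H2).
by move: (cnt Linf n)%:R (lam ^+ n); move=> *; lra.
Qed.

Lemma cnt_SN_lb n : lam ^+ n <= 2 * (cnt (run xpred0 xpredT SN) n)%:R.
Proof.
have H : wLinf SN * lam ^+ n <= 2 * (cnt (run xpred0 xpredT SN) n)%:R.
  apply: cnt_run_lb; first exact: ltW.
    by move=> q; rewrite wLinf_out.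
  by move=> q; have /andP[] := wLinf_itv q.
by rewrite mul1r in H.
Qed.
End LinfWeight.

Section PhiWeight.
Variables (k : nat) (mu : R).
Hypothesis k0 : (0 < k)%N.
Hypothesis mu_itv : 249 / 100 <= mu <= 251 / 100.
Hypothesis mu_le : mu <= lam.
Hypothesis mu_lam : lam - mu <= lam^-1 ^+ k * lam / 100.
Let s := (mu - 1)^-1.
Let rho := mu^-1.
Let t := rho ^+ k.
Let p := s + rho * s ^+ 2 / (1 - s * t).

(* Solves the eigenvector equations for mu in every state but SN, where it leaves
   the slack provided by N_ineq. *)
Definition wPhi (q : state) : R :=
  match q with
  | S0 => (p + s * (1 - rho * t) + (rho * s + (p - s) * t) + 1) * rho
  | SP => p
  | SN => 1
  | SX i => s * (1 - rho ^+ (k.+1 - i).+1)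
  | SY 0 => rho * s + (p - s) * t
  | SY i => s + (p - s) * rho ^+ (k - i)
  end.

Let mu_gt0 : 0 < mu.
Proof. by move: mu_itv => /andP[h _]; move: h; lra. Qed.

Let rho_itv : 39 / 100 <= rho <= 41 / 100. Proof. exact: inv_mu_itv. Qed.
Let s_itv : 33 / 50 <= s <= 17 / 25. Proof. exact: inv_mu1_itv. Qed.

Let rho01 n : 0 <= rho ^+ n <= 1.
Proof.
by case/andP: rho_itv => r1 r2; rewrite exprn_ge0 ?exprn_ile1 //; move: r1 r2; lra.
Qed.

Let t_itv : 0 <= t <= rho.
Proof.
have /andP[r0 r1] := rho01 1; rewrite expr1 in r0 r1.
by rewrite exprn_ge0 //= /t -(prednK k0) exprS ler_piMr ?exprn_ile1.
Qed.

Let t_ge : lam^-1 ^+ k <= t.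
Proof.
have /andP[r0 r1] := rho01 1; rewrite expr1 in r0 r1.
have lr : lam^-1 <= rho by rewrite /rho lef_pV2 ?posrE.
by apply: lerXn2r => //; rewrite nnegrE ?invr_ge0 ?(ltW lam_gt0).
Qed.

(** The quartic at [mu] is at least -14 (lam - mu), and 14 * 2.51 / 100 < 9/25: hence the 1/100 in
    [mu_lam]. *)
Let quartic_lb : - (9 / 25) * t <= mu ^+ 4 - 3 * mu ^+ 3 + mu ^+ 2 + mu - 1.
Proof.
have := quartic_diff mu_itv lam_itv' mu_le; rewrite lam_root sub0r.
have /andP[t0 _] := t_itv; have /andP[_ l2] := lam_itv.
have h : lam - mu <= t * (251 / 100) / 100.
  apply: le_trans mu_lam _; apply: ler_wpM2r; first by lra.
  by apply: ler_pM => //; rewrite ?(ltW lam_gt0) // exprn_ge0 // invr_ge0 ltW.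
by move: (mu ^+ 4 - _ + _ + _ - 1) h t0; move=> *; lra.
Qed.

Lemma wPhi_out q : out (fun i => k <= i)%N (fun i => i <= k)%N wPhi q <= mu * wPhi q.
Proof.
have HN : 1 + p + s * (1 - rho * t) <= mu by exact: N_ineq quartic_lb.
have pe : mu * p = p + (1 + (rho * s + (p - s) * t)) by exact: p_fix.
have mr : rho * mu = 1 by rewrite mulVf ?lt0r_neq0.
have ms : s * (mu - 1) = 1.
  rewrite mulVf //; apply: lt0r_neq0; move: mu_itv => /andP[h _]; move: h; lra.
have mus : mu * s = s + 1 by rewrite -[1]ms; ring.
have mr' x : mu * (rho * x) = x by rewrite mulrA (mulrC mu) mr mul1r.
have et : rho ^+ (k.+1 - 1).+1 = rho * t by rewrite subn1 exprS.
have e0 m : (k <= m)%N -> (k - m = 0)%N by move=> ?; apply/eqP; rewrite subn_eq0.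
rewrite outE; case: q => [|||i|[|i]] /=; rewrite ?et.
- by rewrite (mulrC _ rho) mr'.
- by rewrite pe le_eqVlt; apply/orP; left; apply/eqP; ring.
- by rewrite mulr1 addr0 [_ + 1]addrC addrA.
- rewrite !add0r addr0 mulrBr mulr1; case: leqP => ik.
    rewrite /wPhi subSS (subSn ik) (exprS _ (k - i).+1) (mulrCA s).
    by rewrite !mulrBr mulr1 mus mr' addrAC.
  (* Here [k < i]: no further X is allowed, and the truncated difference is 0. *)
  rewrite (_ : k.+1 - i = 0)%N; last by apply/eqP; rewrite subn_eq0.
  by rewrite expr1 mulrBr mus (mulrC s) mr' add0r addrAC subrr add0r.
- rewrite /wPhi leqNgt k0 /= !addr0 mulrDr mr' (mulrCA mu) /t -{2}(prednK k0) exprS mr'.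
  by rewrite subn1.
rewrite /wPhi addr0; case: leqP => ik.
  rewrite (e0 i.+2 (leqW ik)) (e0 i.+1 ik) expr0 !mulr1 [s + _]addrC subrK pe.
  by rewrite le_eqVlt; apply/orP; left; apply/eqP; ring.
rewrite addr0 -(subnSK ik) exprS mulrDr mus (mulrCA mu) mr'.
by rewrite addrAC.
Qed.

Lemma wPhi_ge q : 1 / 4 <= wPhi q.
Proof.
have /andP[p1 p2] : s <= p <= 1 by exact: p_itv.
have Hs := s_itv; have Hr := rho_itv; have /andP[t0 t1] := t_itv.
have c0 : 0 <= 33 / 50 :> R by lra.
have r0 : 0 <= 39 / 100 :> R by lra.
have /andP[rs _] := le_mul_itv r0 c0 Hr Hs.
have [s1 s2] := andP Hs; have [r1 r2] := andP Hr.
have ps n : 0 <= (p - s) * rho ^+ n.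
  by rewrite mulr_ge0 ?subr_ge0 //; case/andP: (rho01 n).
have HX n : 1 / 4 <= s * (1 - rho ^+ n.+1).
  have rn : rho ^+ n.+1 <= 41 / 100.
    rewrite exprS; apply: le_trans r2; rewrite ler_piMr //; last by case/andP: (rho01 n).
    by apply: le_trans r1.
  have : 33 / 50 * (59 / 100) <= s * (1 - rho ^+ n.+1).
    by apply: ler_pM => //; [lra | move: rn; lra].
  by move=> /(le_trans _); apply; lra.
have Y0 : 1 / 4 <= rho * s + (p - s) * t.
  by have := ps k; rewrite -/t; move: rs; move=> ? ?; lra.
case: q => [|||i|[|i]] /=.
- have hX := HX k; rewrite exprS -/t in hX.
  have : 1 * (39 / 100) <= (p + s * (1 - rho * t) + (rho * s + (p - s) * t) + 1) * rho.
    by apply: ler_pM => //; move: hX Y0 p1 s1; move=> *; lra.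
  by move=> /(le_trans _); apply; lra.
- by move: s1 p1; lra.
- by lra.
- exact: HX.
- exact: Y0.
by have := ps (k - i.+1)%N; move: s1; move=> *; lra.
Qed.

Lemma wPhi_S0 : wPhi S0 <= 2.
Proof.
have /andP[p1 p2] : s <= p <= 1 by exact: p_itv.
have [s1 s2] := andP s_itv; have [r1 r2] := andP rho_itv; have /andP[t0 t1] := t_itv.
have hs : 0 <= s by apply: le_trans s1; lra.
have hr : 0 <= rho by apply: le_trans r1; lra.
have h1 : s * (1 - rho * t) <= s.
  by rewrite ler_piMr // lerBlDr lerDl mulr_ge0.
have h2 : rho * s <= 1 by rewrite mulr_ile1 //; [move: r2 | move: s2]; lra.
have h3 : (p - s) * t <= 1.
  by rewrite mulr_ile1 ?subr_ge0 //; [move: p2 hs | move: t1 r2]; lra.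
rewrite /=.
have : (p + s * (1 - rho * t) + (rho * s + (p - s) * t) + 1) * rho <=
    (1 + 17 / 25 + (1 + 1) + 1) * (41 / 100).
  apply: ler_pM => //; last by move: p2 h1 h2 h3 s2; move=> *; lra.
  apply: addr_ge0 => //; apply: addr_ge0; last first.
    by apply: addr_ge0; apply: mulr_ge0; rewrite ?subr_ge0.
  apply: addr_ge0; first exact: le_trans p1.
  apply: mulr_ge0 => //; rewrite subr_ge0 mulr_ile1 //; [move: r2 | move: t1 r2]; lra.
move/le_trans; apply; lra.
Qed.

Lemma cnt_Phi_ub n : (cnt (Phi k) n)%:R <= 8 * mu ^+ n.
Proof.
have H : (1 / 4) * (cnt (Phi k) n)%:R <= wPhi S0 * mu ^+ n.
  by apply: cnt_run_ub; [exact: ltW | exact: wPhi_out | exact: wPhi_ge].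
have := le_trans H (ler_wpM2r (exprn_ge0 n (ltW mu_gt0)) wPhi_S0).
by move: (cnt (Phi k) n)%:R (mu ^+ n); move=> *; lra.
Qed.

End PhiWeight.
End Bounds.

(** * A family of potentially positive words *)

Local Close Scope ring_scope.

HB.instance Definition _ (u v : F2) :=
  isMultiplicative.Build F2 F2 (subst u v) (substM u v).

Lemma hom_ext f f' : hom f -> hom f' -> f gx = f' gx -> f gy = f' gy -> f =1 f'.
Proof. by move=> H H' ex ey g; rewrite (hom_gen g H) (hom_gen g H') ex ey. Qed.

Lemma hom_exp f g n : hom f -> f (g ^+ n)%g = (f g ^+ n)%g.
Proof. by move=> H; elim: n => [|n IHn]; rewrite ?expg0 ?hom1 // !expgS H IHn. Qed.

Definition Pos (g : F2) := exists2 u, positive_letters u & g = elem u.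

Lemma PosM g h : Pos g -> Pos h -> Pos (g * h)%g.
Proof.
move=> [u pu ->] [v pv ->]; exists (u ++ v); rewrite ?elem_cat //.
by rewrite /positive_letters all_cat; apply/andP.
Qed.

Lemma Pos1 : Pos 1%g. Proof. by exists [::]; rewrite ?elem0. Qed.
Lemma Pos_gx : Pos gx. Proof. by exists [:: lx]; rewrite ?elem1. Qed.
Lemma Pos_gy : Pos gy. Proof. by exists [:: ly]; rewrite ?elem1. Qed.

Lemma PosX g n : Pos g -> Pos (g ^+ n)%g.
Proof.
move=> Hg; elim: n => [|n IHn]; first exact: Pos1.
by rewrite expgS; apply: PosM.
Qed.

Lemma Pos_positive_word g : Pos g -> positive_word g.
Proof.
move=> [u pu ->]; exists (map fst u); rewrite big_map /elem.
elim: u pu => [|a u IHu] /=; first by rewrite !big_nil.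
case/andP=> Ha /IHu e; rewrite !big_cons -e; congr (_ * _)%g.
by case: a Ha => i [] //= _; apply: word_inj.
Qed.

Section Untwist.
Variable k : nat.
Let c : F2 := (gx * gy)%g.

(* The images of Y, YX, .., YX^k and of x^i, x^i y (i > 0) after Y are positive. *)
Definition untwist : F2 -> F2 := subst c (c ^- k * gy^-1)%g.

Lemma untwist_x : untwist gx = c. Proof. exact: subst_gl. Qed.
Lemma untwist_y : untwist gy = (c ^- k * gy^-1)%g. Proof. exact: subst_gl. Qed.
Lemma untwist_X : untwist (gl lX) = c^-1%g. Proof. exact: subst_gl. Qed.
Lemma untwist_Y : untwist (gl lY) = (gy * c ^+ k)%g.
Proof. by rewrite /untwist subst_gl /basis_letter /= invgM !invgK. Qed.

Lemma hom_untwist : hom untwist. Proof. exact: substM. Qed.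

Lemma untwist_bij : bijective untwist.
Proof.
pose psi := subst (gx ^+ k.+1 * gy)%g (gy^-1 * gx ^- k)%g.
have hp : hom psi by exact: substM.
have psi_x : psi gx = (gx ^+ k.+1 * gy)%g by exact: subst_gl.
have psi_y : psi gy = (gy^-1 * gx ^- k)%g by exact: subst_gl.
have psi_c : psi c = gx.
  by rewrite hp psi_x psi_y mulgA mulgK expgS mulgK.
exists psi.
  apply: (@hom_ext (fun g => psi (untwist g)) id) => //.
  - exact: (hom_comp hp hom_untwist).
  - by rewrite untwist_x.
  rewrite untwist_y hp (homV _ hp) (homV _ hp) hom_exp // psi_c psi_y.
  by rewrite invgM !invgK mulgA mulVg mul1g.
apply: (@hom_ext (fun g => untwist (psi g)) id) => //.
- exact: (hom_comp hom_untwist).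
- rewrite psi_x hom_untwist hom_exp ?untwist_x ?untwist_y; last exact: hom_untwist.
  by rewrite expgS -mulgA mulVKg /c mulgK.
rewrite psi_y hom_untwist !(homV _ hom_untwist) hom_exp ?untwist_x ?untwist_y;
  last exact: hom_untwist.
by rewrite invgM !invgK mulgK.
Qed.

(** The final powers of [c] are a reserve that absorbs the c^-1 of each X and the c^-k of a y. [S0]
    is excluded since reading starts after Y. *)
Definition untwist_inv (q : state) (g : F2) : Prop :=
  match q with
  | S0 => False
  | SN => exists2 h, Pos h & g = (h * gy * c ^+ k)%g
  | SP => exists2 h, Pos h & g = (h * c ^+ k.+1)%g
  | SX i => exists2 h, Pos h & g = (h * gy * c ^+ (k - i))%g
  | SY _ => Pos g
  end.

Lemma untwist_inv_Pos q g : untwist_inv q g -> Pos g.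
Proof.
have Pc : Pos c by apply: PosM; [apply: Pos_gx | apply: Pos_gy].
case: q => //= [||i] [h Hh ->]; repeat (apply: PosM => //); rewrite -?/c.
all: by [exact: Pos_gy | exact: PosX | exact: Pos_gx].
Qed.

(** The length bound keeps every run of X within [k], so the reserve in [untwist_inv] suffices and
    [k - i] is never truncated. *)
Lemma run_Pos q t g : (if q is SX i then i else 0) + size t <= k ->
  run xpred0 xpredT q t -> untwist_inv q g -> Pos (g * untwist (elem t))%g.
Proof.
have Pc : Pos c by apply: PosM; [apply: Pos_gx | apply: Pos_gy].
have PY h : Pos h -> untwist_inv SN (h * untwist (gl lY))%g.
  by move=> Hh; exists h; rewrite ?untwist_Y ?mulgA.
elim: t q g => [|a t IHt] q g.
  by move=> _ _ /untwist_inv_Pos; rewrite elem0 (hom1 hom_untwist) mulg1.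
move=> Hk Hr Hg; have Pg := untwist_inv_Pos Hg.
rewrite elem_cons hom_untwist mulgA.
move: (Hr) => /=; case Eq: (step _ _ q a) => [q1|] // Hr1.
apply: (IHt q1) => //.
  by move: Eq Hk; elim/letter_ind: a {Hr}; case: q {Hg} => [|||i|[|i]] //= [<-] /=; lia.
move: Eq Hg Hk; elim/letter_ind: a {Hr}; case: q => [|||i|[|i]] //= [<-];
  try by [move=> _ _; apply: PY].
all: rewrite ?untwist_x ?untwist_y ?untwist_X.
- by move=> [h Hh ->] _; exists (h * c)%g; [apply: PosM | rewrite -mulgA -expgSr expgS mulgA].
- move=> [h Hh ->] _; exists (h * gy)%g; last by rewrite -!mulgA -expgSr.
  by apply: PosM => //; exact: Pos_gy.
- by move=> Hg _; apply: PosM.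
- by move=> Hg _; apply: PosM.
- move=> [h Hh ->] Hk; exists h => //; have e : k = (k - 1).+1 by lia.
  by rewrite {1}e expgSr (mulgA (h * gy)%g) mulgK.
- move=> [h Hh ->] Hk; exists h => //; have -> : k - i = (k - i.+1).+1 by lia.
  by rewrite expgSr (mulgA (h * gy)%g) mulgK.
(* Reading y in [SP]: c^(k+1) c^-k y^-1 = c y^-1 = x. *)
move=> [h Hh ->] _; rewrite -(mulgA h) (mulgA (c ^+ k.+1)%g) expgS mulgK /c mulgK.
by apply: PosM => //; exact: Pos_gx.
Qed.

Lemma untwist_pp t : size t <= k -> run xpred0 xpredT SN t ->
  potentially_positive (elem (lY :: t)).
Proof.
move=> Hk Hr; have H : Pos (untwist (elem (lY :: t))).
  rewrite elem_cons hom_untwist; apply: run_Pos Hr _ => //.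
  by exists 1%g; [apply: Pos1 | rewrite untwist_Y mul1g].
exists (untwist : {multiplicative F2 -> F2}); split; first exact: untwist_bij.
exact: Pos_positive_word H.
Qed.
End Untwist.

Lemma num_pp_ge n : cnt (run xpred0 xpredT SN) n <= num_potentially_positive 2 n.+1.
Proof.
pose L s := `[< exists w : F2, potentially_positive w /\ word w = s >].
have -> : num_potentially_positive 2 n.+1 = size (map behead (words L n.+1)).
  by rewrite size_map size_words.
apply: cnt_le => t st Hr; apply/mapP; exists (lY :: t) => //.
rewrite -st; apply: (@mem_words L); apply/asboolP.
exists (elem (lY :: t)); split; first exact: (@untwist_pp (size t)).
by rewrite word_elem //; apply: (@run_reduced xpred0 xpredT S0).
Qed.

(** * Summation over the gaps *)

Local Open Scope ring_scope.

Section Sums.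
Variable R : realFieldType.
Implicit Types a b q z : R.

(** A mean value inequality, used in [gap_sum] to produce telescoping differences. *)
Lemma exprn_diff_ge a b n : 0 <= a -> a <= b ->
  n.+1%:R * (b - a) * a ^+ n <= b ^+ n.+1 - a ^+ n.+1.
Proof.
move=> a0 ab; elim: n => [|n IHn]; first by rewrite !expr1 expr0 mul1r mulr1.
have -> : b ^+ n.+2 - a ^+ n.+2 = b * (b ^+ n.+1 - a ^+ n.+1) + (b - a) * a ^+ n.+1.
  by rewrite !exprS; ring.
have -> : n.+2%:R * (b - a) * a ^+ n.+1 =
    a * (n.+1%:R * (b - a) * a ^+ n) + (b - a) * a ^+ n.+1.
  by rewrite -(natr1 n.+1) !exprS; ring.
rewrite lerD2r; apply: ler_pM => //.
by rewrite !mulr_ge0 ?exprn_ge0 ?subr_ge0 ?ler0n.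
Qed.

Lemma bernoulli q n : 0 <= q <= 1 -> 1 - n%:R * q <= (1 - q) ^+ n.
Proof.
move=> /andP[q0 q1]; elim: n => [|n IHn]; first by rewrite mul0r subr0 expr0.
have : (1 - q) * (1 - n%:R * q) <= (1 - q) ^+ n.+1.
  by rewrite exprS ler_wpM2l // subr_ge0.
apply: le_trans; rewrite -natr1 -subr_ge0.
have -> : (1 - q) * (1 - n%:R * q) - (1 - (n%:R + 1) * q) = n%:R * (q * q) by ring.
by rewrite !mulr_ge0 ?ler0n.
Qed.

Lemma geometric_le z n : 0 <= z -> z < 1 -> \sum_(0 <= j < n) z ^+ j <= (1 - z)^-1.
Proof.
move=> z0 z1; rewrite -[_^-1]mul1r ler_pdivlMr ?subr_gt0 //.
suff -> : (\sum_(0 <= j < n) z ^+ j) * (1 - z) = 1 - z ^+ n.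
  by rewrite lerBlDr lerDl exprn_ge0.
elim: n => [|n IHn]; first by rewrite big_nil mul0r expr0 subrr.
by rewrite big_nat_recr //= mulrDl IHn exprSr; ring.
Qed.
End Sums.

Section Upper.
Variable R : realType.
Variable lam : R.
Hypothesis lam_root : lam ^+ 4 - 3 * lam ^+ 3 + lam ^+ 2 + lam - 1 = 0.
Hypothesis lam_itv : 5 / 2 <= lam <= 251 / 100.
Let z := lam^-1.

Let lam_gt0 : 0 < lam.
Proof. by move: lam_itv => /andP[h _]; lra. Qed.

Let z_itv : 39 / 100 <= z <= 2 / 5.
Proof.
by case/andP: lam_itv => h1 h2; rewrite le_invr ?invr_le //; lra.
Qed.

Let q (k : nat) : R := z ^+ k / 100.

Let zX k : 0 <= z ^+ k <= 1.
Proof.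
by case/andP: z_itv => h1 h2; rewrite exprn_ge0 ?exprn_ile1 //; lra.
Qed.

Let q_itv k : 0 <= q k <= 1.
Proof. by case/andP: (zX k) => h1 h2; rewrite /q; apply/andP; split; lra. Qed.

Lemma cnt_Phi_le k n : (0 < k)%N ->
  (cnt (Phi k) n)%:R <= 8 * (lam * (1 - q k)) ^+ n.
Proof.
move=> k0; have zk : 0 <= z ^+ k <= 2 / 5.
  case/andP: (zX k) => -> _ /=; rewrite -(prednK k0) exprS.
  case/andP: z_itv => h1 h2; apply: le_trans h2.
  rewrite ler_piMr //; last by case/andP: (zX k.-1).
  lra.
case/andP: lam_itv => l1 l2; case/andP: zk => zk1 zk2.
have lq : 0 <= lam * q k <= lam * (4 / 1000).
  apply/andP; split; first by rewrite mulr_ge0 ?(ltW lam_gt0) //; case/andP: (q_itv k).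
  by rewrite ler_wpM2l ?(ltW lam_gt0) // /q; lra.
case/andP: lq => lq1 lq2.
apply: (cnt_Phi_ub lam_root lam_itv k0).
- rewrite mulrBr mulr1; apply/andP; split; lra.
- rewrite mulrBr mulr1; lra.
- rewrite mulrBr mulr1 opprB addrCA subrr addr0 /q mulrA (mulrC lam) //.
Qed.

(** Each product is at most 64 mu^(m-k), and mu^(m-k) is at most 2 z^k lam^m (1 - q_k)^m. As z^k =
    100 q_k and q_k <= 2 (q_k - q_(k+1)), [exprn_diff_ge] applies, with the constant 64 * 2 * 100 *
    2. *)
Let gap_sum k m : (0 < k <= m)%N ->
  \sum_(0 <= j < (m - k).+1) (cnt (Phi k) j)%:R * (cnt (Phi k) (m - k - j))%:R
  <= 128 * 200 * lam ^+ m * ((1 - q k.+1) ^+ m.+1 - (1 - q k) ^+ m.+1) :> R.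
Proof.
move=> /andP[k0 km]; set mu := lam * (1 - q k).
have /andP[q0 q1] := q_itv k.
have mu0 : 0 <= mu by rewrite mulr_ge0 ?(ltW lam_gt0) ?subr_ge0.
have step1 : \sum_(0 <= j < (m - k).+1) (cnt (Phi k) j)%:R * (cnt (Phi k) (m - k - j))%:R
    <= (m.+1)%:R * (64 * mu ^+ (m - k)) :> R.
  apply: (@le_trans _ _ (\sum_(0 <= j < (m - k).+1) 64 * mu ^+ (m - k))).
    rewrite !big_mkord; apply: ler_sum => j _.
    have -> : 64 * mu ^+ (m - k) = (8 * mu ^+ j) * (8 * mu ^+ (m - k - j)).
      by rewrite -{1}(subnKC (_ : j <= m - k)%N) ?exprD; [ring | rewrite -ltnS].
    by apply: ler_pM; rewrite ?ler0n // cnt_Phi_le.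
  rewrite big_const_nat subn0 iter_addr_0 -[leLHS]mulr_natl.
  apply: ler_wpM2r; first by rewrite mulr_ge0 ?exprn_ge0 ?ler0n.
  by rewrite ler_nat ltnS leq_subr.
apply: le_trans step1 _.
(* Bernoulli with k z^k <= (2 z)^k <= 1 even gives (1 - q_k)^k >= 99/100. *)
have half : 1 <= 2 * (1 - q k) ^+ k.
  have zk : k%:R * z ^+ k <= 1.
    case/andP: z_itv => h1 h2; apply: (@le_trans _ _ ((2 * z) ^+ k)).
      rewrite exprMn ler_wpM2r ?exprn_ge0 //; first lra.
      by rewrite -natrX ler_nat ltnW // ltn_expl.
    by rewrite exprn_ile1 //; lra.
  have := bernoulli k (q_itv k); rewrite /q mulrA => hb.
  have : 1 - 1 / 100 <= (1 - q k) ^+ k by apply: le_trans hb; lra.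
  lra.
have muE : mu ^+ (m - k) <= 2 * (z ^+ k * (lam ^+ m * (1 - q k) ^+ m)).
  have zl : z ^+ k * lam ^+ k = 1 by rewrite -exprMn mulVf ?expr1n // lt0r_neq0.
  have -> : 2 * (z ^+ k * (lam ^+ m * (1 - q k) ^+ m)) =
      (2 * (1 - q k) ^+ k) * mu ^+ (m - k).
    transitivity ((z ^+ k * lam ^+ k) * (2 * (1 - q k) ^+ k) * mu ^+ (m - k)).
      by rewrite -{1 2}(subnKC km) /mu exprMn !exprD; ring.
    by rewrite zl mul1r.
  by rewrite ler_peMl ?exprn_ge0.
have tel := @exprn_diff_ge R (1 - q k) (1 - q k.+1) m.
have qS : q k.+1 <= q k / 2.
  rewrite /q exprS; case/andP: z_itv => h1 h2.
  have : z * z ^+ k <= 2 / 5 * z ^+ k by apply: ler_wpM2r => //; case/andP: (zX k).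
  case/andP: (zX k) => ? ? ?; lra.
have tel' : m.+1%:R * (q k / 2) * (1 - q k) ^+ m <=
    (1 - q k.+1) ^+ m.+1 - (1 - q k) ^+ m.+1.
  apply: le_trans (tel _ _); [|by rewrite subr_ge0|lra].
  apply: ler_wpM2r; first by rewrite exprn_ge0 // subr_ge0.
  by apply: ler_wpM2l; rewrite ?ler0n //; lra.
have lm : 0 <= lam ^+ m by rewrite exprn_ge0 ?ltW.
have H1 := ler_wpM2l (ler0n R m.+1) (ler_wpM2l (ler0n R 64) muE).
apply: le_trans H1 _.
have H2 := ler_wpM2l lm tel'.
have -> : m.+1%:R * (64 * (2 * (z ^+ k * (lam ^+ m * (1 - q k) ^+ m)))) =
    128 * 200 * (lam ^+ m * (m.+1%:R * (q k / 2) * (1 - q k) ^+ m)).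
  by rewrite /q; field.
by rewrite -[leRHS]mulrA ler_wpM2l // mulr_ge0 ?ler0n.
Qed.

Lemma cnt_PhiU_le m : (cnt PhiU m)%:R <= (8 + 128 * 200) * lam ^+ m.
Proof.
apply: (@le_trans _ _ (cnt Linf m + \sum_(1 <= g < m.+1) \sum_(0 <= j < (m - g).+1)
    cnt (Phi g) j * cnt (Phi g) (m - g - j))%:R); first by rewrite ler_nat cnt_PhiU.
have lm : 0 <= lam ^+ m by rewrite exprn_ge0 ?ltW.
rewrite natrD mulrDl; apply: lerD; first exact: cnt_Linf_ub.
rewrite natr_sum.
apply: (@le_trans _ _ (\sum_(1 <= g < m.+1)
    128 * 200 * lam ^+ m * ((1 - q g.+1) ^+ m.+1 - (1 - q g) ^+ m.+1))).
  rewrite big_nat_cond [leRHS]big_nat_cond; apply: ler_sum => g /andP[/andP[g1 gm] _].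
  rewrite natr_sum; under eq_bigr do rewrite natrM.
  by apply: gap_sum; rewrite g1.
(* What remains of the telescoped sum is a difference of two numbers in [0, 1]. *)
rewrite -mulr_sumr telescope_sumr // ler_piMr //.
  by rewrite !mulr_ge0 ?ler0n.
have /andP[a0 a1] := q_itv m.+1; have /andP[b0 b1] := q_itv 1.
have h1 : (1 - q m.+1) ^+ m.+1 <= 1 by rewrite exprn_ile1 //; lra.
have h2 : 0 <= (1 - q 1) ^+ m.+1 by rewrite exprn_ge0 //; lra.
lra.
Qed.

Lemma num_pp_ub : exists C : R, forall n,
  (num_potentially_positive 2 n)%:R <= C * lam ^+ n.
Proof.
exists (512 * (8 + 128 * 200) * (1 - 4 * z ^+ 2)^-1) => n.
apply: le_trans (_ : (\sum_(0 <= j < n./2.+1) 4 ^ j * cnt PhiS (n - j.*2))%:R <= _).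
  by rewrite ler_nat num_pp_le.
have z4 : 0 <= 4 * z ^+ 2 < 1.
  have zz : 0 <= z ^+ 2 <= 2 / 5 * (2 / 5).
    case/andP: z_itv => h1 h2; rewrite sqr_ge0 expr2 /= ler_pM //; lra.
  by case/andP: zz => ? ?; apply/andP; split; lra.
case/andP: z4 => z40 z41.
have lm : 0 <= lam ^+ n by rewrite exprn_ge0 ?ltW.
rewrite natr_sum.
apply: (@le_trans _ _ (\sum_(0 <= j < n./2.+1)
    512 * (8 + 128 * 200) * lam ^+ n * (4 * z ^+ 2) ^+ j)).
  rewrite big_nat_cond [leRHS]big_nat_cond; apply: ler_sum => j /andP[/andP[_ jn] _].
  have jn2 : (j.*2 <= n)%N by lia.
  have zl : z ^+ j.*2 * lam ^+ j.*2 = 1 by rewrite -exprMn mulVf ?expr1n // lt0r_neq0.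
  have -> : 512 * (8 + 128 * 200) * lam ^+ n * (4 * z ^+ 2) ^+ j =
      4 ^+ j * (512 * ((8 + 128 * 200) * lam ^+ (n - j.*2))).
    rewrite -{1}(subnKC jn2) exprD exprMn -exprM mul2n.
    transitivity (4 ^+ j * (512 * ((8 + 128 * 200) * lam ^+ (n - j.*2))) *
      (z ^+ j.*2 * lam ^+ j.*2)).
      by ring.
    by rewrite zl mulr1.
  rewrite natrM natrX ler_wpM2l ?exprn_ge0 //.
  apply: (@le_trans _ _ (512 * cnt PhiU (n - j.*2))%:R); first by rewrite ler_nat cnt_PhiS.
  by rewrite natrM ler_wpM2l ?ler0n // cnt_PhiU_le.
rewrite -mulr_sumr [leRHS]mulrAC ler_wpM2l ?geometric_le //.
by rewrite !mulr_ge0 ?ler0n // addr_ge0 ?mulr_ge0.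
Qed.
End Upper.

(** * The root *)

Section Root.
Variable R : realType.

Lemma quartic_root (d : R) :
  d = 2 + 5050 / 10 ^+ 4 + 6841 / 10 ^+ 8 + 3621 / 10 ^+ 12 + 47 / 10 ^+ 14 ->
  exists2 lam : R, `|lam - d| <= 1 / 2 / 10 ^+ 14
    & lam ^+ 4 - 3 * lam ^+ 3 + lam ^+ 2 + lam - 1 = 0.
Proof.
move=> ed; pose e : R := 1 / 2 / 10 ^+ 14.
pose p : {poly R} := 'X^4 - 3 *: 'X^3 + 'X^2 + 'X - 1.
have pE x : p.[x] = x ^+ 4 - 3 * x ^+ 3 + x ^+ 2 + x - 1 by rewrite /p !hornerE.
have e0 : 0 < e by rewrite /e; lra.
have pl : p.[d - e] < 0.
  rewrite pE ed /e. lra.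
have pu : 0 < p.[d + e].
  rewrite pE ed /e. lra.
have [||x /andP[x1 x2] /eqP] := @poly_ivt R p (d - e) (d + e).
- lra.
- by rewrite !ltW.
rewrite pE => rx; exists x => //.
by rewrite ler_distl -/e x1.
Qed.

(** At a point [lam >= 5 / 2] all nonconstant Taylor coefficients of the quartic are positive. *)
Lemma quartic_root_max (lam y : R) : 5 / 2 <= lam -> lam < y ->
  lam ^+ 4 - 3 * lam ^+ 3 + lam ^+ 2 + lam - 1 = 0 ->
  y ^+ 4 - 3 * y ^+ 3 + y ^+ 2 + y - 1 != 0.
Proof.
move=> l1 ly rl; apply: lt0r_neq0; rewrite -rl -subr_gt0.
pose w := y - lam; have w0 : 0 < w by rewrite subr_gt0.
have -> : y = lam + w by rewrite /w addrC subrK.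
have -> : (lam + w) ^+ 4 - 3 * (lam + w) ^+ 3 + (lam + w) ^+ 2 + (lam + w) - 1
   - (lam ^+ 4 - 3 * lam ^+ 3 + lam ^+ 2 + lam - 1) =
  w * (lam ^+ 2 * (4 * lam - 9) + (2 * lam + 1)
       + w * (lam * (6 * lam - 9) + 1 + w * (4 * lam - 3 + w))) by ring.
apply: mulr_gt0 => //; apply: addr_gt0.
  apply: addr_gt0; last by lra.
  by apply: mulr_gt0; [apply: exprn_gt0; lra | lra].
apply: mulr_gt0 => //; apply: addr_gt0.
  apply: addr_gt0; last by lra.
  by apply: mulr_gt0; lra.
by apply: mulr_gt0 => //; lra.
Qed.
End Root.

(* The decimal 2.50506841362147 is split into groups of digits because MathComp
   numerals are unary; the error bound is half a unit in the last digit. *)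
Theorem theorem1p2 (R : realType) :
  exists lambda1 : R,
    [/\ largest_root ('X^4 - 3 *: 'X^3 + 'X^2 + 'X - 1) lambda1,
        `|lambda1 - (2 + 5050 / 10 ^+ 4 + 6841 / 10 ^+ 8 + 3621 / 10 ^+ 12
                     + 47 / 10 ^+ 14)| <= 1 / 2 / 10 ^+ 14
      & is_bigTheta (fun n : nat => (num_potentially_positive 2 n)%:R)
                    (fun n : nat => lambda1 ^+ n)].
Proof.
have [lam lam_d lam_root] := @quartic_root R _ erefl; exists lam.
have pE (x : R) : ('X^4 - 3 *: 'X^3 + 'X^2 + 'X - 1).[x] =
    x ^+ 4 - 3 * x ^+ 3 + x ^+ 2 + x - 1 by rewrite !hornerE.
have lam_itv : 5 / 2 <= lam <= 251 / 100.
  by move: lam_d; rewrite ler_distl => /andP[h1 h2]; apply/andP; split; lra.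
have /andP[l1 l2] := lam_itv.
have lam_gt0 : 0 < lam by lra.
split=> //.
  split=> [|y]; rewrite /root pE; first by apply/eqP.
  apply: contraTT; rewrite -ltNge => ly.
  exact: quartic_root_max ly lam_root.
split.
  have [C HC] := num_pp_ub lam_root lam_itv; exists (C + 1), 0%N => n _.
  rewrite mulrDl mul1r; have := exprn_gt0 n lam_gt0; have := HC n; lra.
(* The initial Y of the counted words costs one letter, hence the start at 1 and the factor [lam]; 2
   comes from [cnt_SN_lb], and the added 1 makes the inequality strict. *)
exists (2 * lam + 1), 1%N => [] [|n] // _.
have := cnt_SN_lb lam_root lam_itv n; have := exprn_gt0 n lam_gt0.
have : (cnt (run xpred0 xpredT SN) n)%:R <= (num_potentially_positive 2 n.+1)%:R :> R.
  by rewrite ler_nat num_pp_ge.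
set c := (_%:R : R); set N := (_%:R : R) => cN ln lc.
have lN : lam * lam ^+ n <= lam * (2 * N).
  by rewrite ler_wpM2l ?(ltW lam_gt0) // (le_trans lc) // ler_wpM2l.
rewrite exprS mulrDl mul1r; move: lN; rewrite mulrCA -mulrA; lra.
Qed.
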